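(* Let $X_i$, $i=1,2$, be metric measure spaces satisfying the doubling condition with exponent $n_i$. Assume that the nonnegative self-adjoint operators $L_i$ on $L^2(X_i)$, $i=1,2$, satisfy restriction type estimates $(\mathrm{ST}_{p_i,2}^\infty)$ for some $p_i$ with $1\le p_i<2$. Then there is a constant $C$ such that the following two-parameter restriction type estimates hold. (i) For every $R_1,R_2>0$ and all bounded Borel functions $F$ with $\operatorname{supp}F\subseteq[0,R_1]\times[0,R_2]$, $$\big\|F(\sqrt{L_1},\sqrt{L_2})P_{B_1(x_1,r_1)\times B_2(x_2,r_2)}\big\|_{L^{p_1}(X_1;L^{p_2}(X_2))\to L^2(X_1\times X_2)}\le C\prod_{i=1}^2\Big(\frac{(R_ir_i)^{n_i}}{V_i(x_i,r_i)}\Big)^{1/p_i-1/2}\big\|\delta_{(R_1,R_2)}F\big\|_{L^\infty(\mathbb{R}^2)}$$ for all $x_i\in X_i$ and all $r_i\ge1/R_i$, $i=1,2$. (ii) For every $R_1>0$ and all bounded Borel functions $F$ with $\operatorname{supp}F\subseteq[0,R_1]\times[0,\infty)$, $$\big\|F(\sqrt{L_1},\sqrt{L_2})P_{B_1(x_1,r_1)\times X_2}\big\|_{L^{p_1}(X_1;L^2(X_2))\to L^2(X_1\times X_2)}\le C\Big(\frac{(R_1r_1)^{n_1}}{V_1(x_1,r_1)}\Big)^{1/p_1-1/2}\big\|\delta_{(R_1,1)}F\big\|_{L^\infty(\mathbb{R}^2)}$$ for all $x_1\in X_1$ and all $r_1\ge1/R_1$. (iii) For every $R_2>0$ and all bounded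 Borel functions $F$ with $\operatorname{supp}F\subseteq[0,\infty)\times[0,R_2]$, $$\big\|F(\sqrt{L_1},\sqrt{L_2})P_{X_1\times B_2(x_2,r_2)}\big\|_{L^{p_2}(X_2;L^2(X_1))\to L^2(X_1\times X_2)}\le C\Big(\frac{(R_2r_2)^{n_2}}{V_2(x_2,r_2)}\Big)^{1/p_2-1/2}\big\|\delta_{(1,R_2)}F\big\|_{L^\infty(\mathbb{R}^2)}$$ for all $x_2\in X_2$ and all $r_2\ge1/R_2$.
   Context: For $i=1,2$: $X_i$ has a metric $d_i$ and a Borel measure $\mu_i$; $B_i(x_i,r)$ is the open ball of center $x_i$ and radius $r$, and $V_i(x_i,r)=\mu_i(B_i(x_i,r))$. The doubling condition with exponent $n_i$: there are positive constants $C,n_i$ with $V_i(x_i,\lambda r)\le C\lambda^{n_i}V_i(x_i,r)$ for all $x_i\in X_i$, $\lambda\ge1$, $r>0$. Standing assumption: $\mu_i(X_i)=\infty$. The product $X_1\times X_2$ carries $\mu_1\times\mu_2$. Functional calculus: $E$ is the unique spectral decomposition on $L^2(X_1\times X_2)$ with $E(A_1\times A_2)=E_{L_1}(A_1)\otimes E_{L_2}(A_2)$ for Borel $A_i\subset\mathbb{R}$; $F(\sqrt{L_1},\sqrt{L_2}):=\int F(\sqrt{\lambda_1},\sqrt{\lambda_2})\,dE(\lambda_1,\lambda_2)$. $(\mathrm{ST}^\infty_{p,2})$: for $1\le p<2$, $L_i$ satisfies $(\mathrm{ST}^\infty_{p,2})$ if there is $C>0$ such that for each $R>0$ and all Borel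 functions $F$ on $\mathbb{R}$ with $\operatorname{supp}F\subset[0,R]$, $\|F(\sqrt{L_i})P_{B_i(x_i,r)}\|_{L^p(X_i)\to L^2(X_i)}\le C\big(\frac{(Rr)^{n_i}}{V_i(x_i,r)}\big)^{1/p-1/2}\|F(R\,\cdot)\|_{L^\infty(\mathbb{R})}$ for all $x_i\in X_i$ and $r\ge1/R$. Notation: $P_Ef=\chi_Ef$. $(\delta_{(R_1,R_2)}F)(\lambda_1,\lambda_2)=F(R_1\lambda_1,R_2\lambda_2)$. Mixed norms: $\|f\|_{L^{p}(X_1;L^{q}(X_2))}=\big\|\,\|f(x_1,x_2)\|_{L^{q}_{x_2}(X_2)}\big\|_{L^{p}_{x_1}(X_1)}$ and $\|f\|_{L^{p}(X_2;L^{q}(X_1))}=\big\|\,\|f(x_1,x_2)\|_{L^{q}_{x_1}(X_1)}\big\|_{L^{p}_{x_2}(X_2)}$. *)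

(* Defs.v *)
From HB Require Import structures.
From mathcomp Require Import all_boot all_order all_algebra.
From mathcomp Require Import all_classical all_reals all_analysis.
From mathcomp Require Export complex.

Set Implicit Arguments.
Unset Strict Implicit.
Unset Printing Implicit Defensive.

Import Order.TTheory GRing.Theory Num.Theory.
Import numFieldNormedType.Exports.

Local Open Scope classical_set_scope.
Local Open Scope ring_scope.

#[short(type="metricMeasurableType")]
HB.structure Definition MetricMeasurable (R : numDomainType)
    (d : measure_display) := {X of Metric R X & Measurable d X}.

(* [ball x r] is the open ball (ballEmdist). Finiteness of balls is implicit in
   the use of V(x, r) as a number; V(x, r) > 0 need not be assumed, since
   V(x, r) = 0 would give mu X = 0 by doubling. *)
Definition doubling_space (R : realType) (d : measure_display)
    (X : metricMeasurableType R d) (mu : {measure set X -> \bar R}) (n : R) :=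
  [/\ @measurable d X = <<s [set U : set X | open U] >>,
      forall (x : X) (r : R), 0 < r -> (mu (ball x r) < +oo)%E,
      mu setT = +oo%E,
      0 < n &
      exists2 C : R, 0 < C & forall (x : X) (lambda r : R),
        1 <= lambda -> 0 < r ->
        (mu (ball x (lambda * r)) <= (C * lambda `^ n)%:E * mu (ball x r))%E].

Definition vol (R : realType) (d : measure_display)
    (X : metricMeasurableType R d) (mu : {measure set X -> \bar R})
    (x : X) (r : R) : R := fine (mu (ball x r)).

(** Complex-valued functions *)

Definition cmeasurable (R : realType) (d : measure_display)
    (T : measurableType d) (f : T -> R[i]) :=
  measurable_fun setT (fun x => complex.Re (f x)) /\
  measurable_fun setT (fun x => complex.Im (f x)).

(* The modulus as an extended real function, as expected by [Lnorm]. *)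
Definition cabs (R : realType) (T : Type) (f : T -> R[i]) (x : T) : \bar R :=
  (Normc.normc (f x))%:E.

Definition cLnorm (R : realType) (d : measure_display) (T : measurableType d)
    (mu : {measure set T -> \bar R}) (p : \bar R) (f : T -> R[i]) : \bar R :=
  'N[mu]_p[cabs f]%E.

(* [nu] is only required to be a set function because it is also used with
   A |-> <E(A) f, f>, which is a measure only on measurable sets. *)
Definition cintegral (R : realType) (d : measure_display)
    (T : measurableType d) (nu : set T -> \bar R) (f : T -> R[i]) : R[i] :=
  Complex (fine (\int[nu]_x (complex.Re (f x))%:E)%E)
          (fine (\int[nu]_x (complex.Im (f x))%:E)%E).

(* L^2(T; C), on representatives: its elements are to be read up to equality
   mu-almost everywhere, and the operators below are required to respect it. *)
Definition cL2 (R : realType) (d : measure_display) (T : measurableType d)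
    (mu : {measure set T -> \bar R}) : set (T -> R[i]) :=
  [set f | cmeasurable f /\ (cLnorm mu 2%:E f < +oo)%E].

Definition inner (R : realType) (d : measure_display) (T : measurableType d)
    (mu : {measure set T -> \bar R}) (f g : T -> R[i]) : R[i] :=
  cintegral mu (fun x => f x * conjc (g x)).

(* ‖ ‖f(x1, x2)‖_{L^q(x2)} ‖_{L^p(x1)} *)
Definition mixed_norm12 (R : realType) (d1 d2 : measure_display)
    (T1 : measurableType d1) (T2 : measurableType d2)
    (mu1 : {measure set T1 -> \bar R}) (mu2 : {measure set T2 -> \bar R})
    (p q : R) (f : T1 * T2 -> R[i]) : \bar R :=
  'N[mu1]_p%:E[(fun x1 => cLnorm mu2 q%:E (fun x2 => f (x1, x2)))]%E.

(* ‖ ‖f(x1, x2)‖_{L^q(x1)} ‖_{L^p(x2)} *)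
Definition mixed_norm21 (R : realType) (d1 d2 : measure_display)
    (T1 : measurableType d1) (T2 : measurableType d2)
    (mu1 : {measure set T1 -> \bar R}) (mu2 : {measure set T2 -> \bar R})
    (p q : R) (f : T1 * T2 -> R[i]) : \bar R :=
  'N[mu2]_p%:E[(fun x2 => cLnorm mu1 q%:E (fun x1 => f (x1, x2)))]%E.

(** Possibly unbounded operators on L^2 *)

Record operator (R : realType) (T : Type) := Operator {
  dom : set (T -> R[i]);
  act :> (T -> R[i]) -> T -> R[i] }.

Definition linear_operator (R : realType) (d : measure_display)
    (T : measurableType d) (mu : {measure set T -> \bar R})
    (A : operator R T) :=
  [/\ dom A `<=` cL2 mu,
      (forall f, dom A f -> cL2 mu (A f)),
      (forall f g, dom A f -> cL2 mu g -> f = g %[ae mu] ->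
        dom A g /\ A f = A g %[ae mu]),
      dom A (fun=> 0) &
      forall (c : R[i]) f g, dom A f -> dom A g ->
        dom A (fun x => c * f x + g x) /\
        A (fun x => c * f x + g x) = (fun x => c * A f x + A g x) %[ae mu]].

Definition densely_defined (R : realType) (d : measure_display)
    (T : measurableType d) (mu : {measure set T -> \bar R})
    (A : operator R T) :=
  forall f (e : R), cL2 mu f -> 0 < e ->
    exists2 g, dom A g & (cLnorm mu 2%:E (fun x => (f x - g x)%R) < e%:E)%E.

(* Symmetric, and the domain of the adjoint is contained in the domain. *)
Definition self_adjoint (R : realType) (d : measure_display)
    (T : measurableType d) (mu : {measure set T -> \bar R})
    (A : operator R T) :=
  [/\ linear_operator mu A, densely_defined mu A,
      (forall f g, dom A f -> dom A g -> inner mu (A f) g = inner mu f (A g)) &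
      forall g, cL2 mu g ->
        (exists2 h, cL2 mu h &
          forall f, dom A f -> inner mu (A f) g = inner mu f h) ->
        dom A g].

Definition nonneg_self_adjoint (R : realType) (d : measure_display)
    (T : measurableType d) (mu : {measure set T -> \bar R})
    (A : operator R T) :=
  self_adjoint mu A /\ forall f, dom A f -> 0 <= inner mu (A f) f.

(* ‖A P_B‖ from the space with norm N to L^2. The operator A P_B is considered
   on the elements of L^2 with N f < +oo, which are dense for the (mixed)
   Lebesgue norms with finite exponents; the value is +oo if A P_B is not
   defined or not bounded there. *)
Definition restricted_opnorm (R : realType) (d : measure_display)
    (T : measurableType d) (mu : {measure set T -> \bar R})
    (N : (T -> R[i]) -> \bar R) (A : operator R T) (B : set T) : \bar R :=
  ereal_inf [set K%:E | K in [set K : R | 0 <= K /\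
    forall f, cL2 mu f -> (N f < +oo)%E ->
      let PBf := patch (fun=> 0) B f in
      dom A PBf /\ (cLnorm mu 2%:E (A PBf) <= K%:E * N f)%E]].

(** Spectral decompositions and functional calculus *)

(* Spectral decompositions (projection-valued measures) on the measurable
   space S, acting on L^2(mu). *)
Definition spectral_decomposition (R : realType) (d d' : measure_display)
    (T : measurableType d) (mu : {measure set T -> \bar R})
    (S : measurableType d') (E : set S -> operator R T) :=
  [/\ (forall A, measurable A ->
        [/\ linear_operator mu (E A), dom (E A) = cL2 mu,
            (forall f, cL2 mu f -> E A (E A f) = E A f %[ae mu]) &
            forall f g, cL2 mu f -> cL2 mu g ->
              inner mu (E A f) g = inner mu f (E A g)]),
      (forall f, cL2 mu f -> E set0 f = (fun=> 0) %[ae mu]),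
      (forall f, cL2 mu f -> E setT f = f %[ae mu]),
      (forall A B f, measurable A -> measurable B -> cL2 mu f ->
        E (A `&` B) f = E A (E B f) %[ae mu]) &
      forall (A : nat -> set S) f, (forall k, measurable (A k)) ->
        trivIset setT A -> cL2 mu f ->
        cLnorm mu 2%:E (fun x =>
            E (\bigcup_k A k) f x - \sum_(k < n) E (A k) f x)
          @[n --> \oo] --> 0%E].

Definition spectral_measure (R : realType) (d d' : measure_display)
    (T : measurableType d) (mu : {measure set T -> \bar R})
    (S : measurableType d') (E : set S -> operator R T)
    (f : T -> R[i]) (A : set S) : \bar R :=
  (complex.Re (inner mu (E A f) f))%:E.

(* A = \int F dE, on its maximal domain. A linear operator on a dense subspace
   of a complex Hilbert space is determined by its quadratic form. *)
Definition is_spectral_integral (R : realType) (d d' : measure_display)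
    (T : measurableType d) (mu : {measure set T -> \bar R})
    (S : measurableType d') (E : set S -> operator R T) (F : S -> R[i])
    (A : operator R T) :=
  [/\ linear_operator mu A,
      dom A = [set f | cL2 mu f /\
        (\int[spectral_measure mu E f]_s (cabs F s * cabs F s) < +oo)%E] &
      forall f, dom A f ->
        inner mu (A f) f = cintegral (spectral_measure mu E f) F].

Definition spectral_resolution (R : realType) (d : measure_display)
    (T : measurableType d) (mu : {measure set T -> \bar R})
    (L : operator R T) (E : set R -> operator R T) :=
  spectral_decomposition mu E /\
  is_spectral_integral mu E (fun lambda : R => Complex lambda 0) L.

(* A = F(sqrt L). [Num.sqrt] vanishes on negative numbers, which do not meet
   the spectrum of a nonnegative L. *)
Definition is_fun_sqrt (R : realType) (d : measure_display)
    (T : measurableType d) (mu : {measure set T -> \bar R})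
    (L : operator R T) (F : R -> R[i]) (A : operator R T) :=
  exists E : set R -> operator R T,
    spectral_resolution mu L E /\
    is_spectral_integral mu E (fun lambda => F (Num.sqrt lambda)) A.

(* E(A1 x A2) = E1(A1) (x) E2(A2); the tensor product of two bounded operators
   is determined by its values on elementary tensors. *)
Definition joint_decomposition (R : realType) (d1 d2 : measure_display)
    (T1 : measurableType d1) (T2 : measurableType d2)
    (mu1 : {sigma_finite_measure set T1 -> \bar R})
    (mu2 : {sigma_finite_measure set T2 -> \bar R})
    (E1 : set R -> operator R T1) (E2 : set R -> operator R T2)
    (E : set (R * R) -> operator R (T1 * T2)) :=
  spectral_decomposition (mu1 \x mu2)%E E /\
  forall (A1 A2 : set R) f1 f2, measurable A1 -> measurable A2 ->
    cL2 mu1 f1 -> cL2 mu2 f2 ->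
    E (A1 `*` A2) (fun x => f1 x.1 * f2 x.2) =
      (fun x => E1 A1 f1 x.1 * E2 A2 f2 x.2) %[ae (mu1 \x mu2)%E].

(* A = F(sqrt L1, sqrt L2) *)
Definition is_joint_fun_sqrt (R : realType) (d1 d2 : measure_display)
    (T1 : measurableType d1) (T2 : measurableType d2)
    (mu1 : {sigma_finite_measure set T1 -> \bar R})
    (mu2 : {sigma_finite_measure set T2 -> \bar R})
    (L1 : operator R T1) (L2 : operator R T2) (F : R * R -> R[i])
    (A : operator R (T1 * T2)) :=
  exists E1 E2 E,
    [/\ spectral_resolution mu1 L1 E1, spectral_resolution mu2 L2 E2,
        joint_decomposition mu1 mu2 E1 E2 E &
        is_spectral_integral (mu1 \x mu2)%E E
          (fun l => F (Num.sqrt l.1, Num.sqrt l.2)) A].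

(** Restriction type estimates *)

(* For Borel functions of the spectral variable, the L^oo norm can be read as
   the Lebesgue essential supremum or, so as not to exclude operators with
   point spectrum, as the supremum. Neither reading of an implication between
   estimates in these norms implies the other one. *)
Inductive Linf_reading := Linf_ess | Linf_sup.

Definition Linf_norm (reading : Linf_reading) (R : realType)
    (d : measure_display) (S : measurableType d)
    (m : {measure set S -> \bar R}) (F : S -> R[i]) : \bar R :=
  match reading with
  | Linf_ess => cLnorm m +oo F
  | Linf_sup => ereal_sup (range (cabs F))
  end.

Definition supp (R : realType) (S : topologicalType) (F : S -> R[i]) : set S :=
  closure [set s | F s != 0].

Definition cbounded (R : realType) (S : Type) (F : S -> R[i]) :=
  exists M : R, forall s, Normc.normc (F s) <= M.

Definition dilate (R : realType) (a : R * R) (F : R * R -> R[i])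
    (l : R * R) : R[i] := F (a.1 * l.1, a.2 * l.2).

Definition restriction_factor (R : realType) (d : measure_display)
    (X : metricMeasurableType R d) (mu : {measure set X -> \bar R})
    (n p Rad : R) (x : X) (r : R) : R :=
  ((Rad * r) `^ n / vol mu x r) `^ (p^-1 - 2^-1).

(* The condition (ST^oo_{p,2}) for L. *)
Definition ST_inf (reading : Linf_reading) (R : realType)
    (d : measure_display) (X : metricMeasurableType R d)
    (mu : {measure set X -> \bar R}) (n p : R) (L : operator R X) :=
  exists2 C : R, 0 < C &
    forall (Rad : R) (F : R -> R[i]) (A : operator R X),
      0 < Rad -> cmeasurable F -> supp F `<=` `[0, Rad] ->
      is_fun_sqrt mu L F A ->
      forall (x : X) (r : R), Rad^-1 <= r ->
        (restricted_opnorm mu (cLnorm mu p%:E) A (ball x r) <=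
         (C * restriction_factor mu n p Rad x r)%:E *
         Linf_norm reading lebesgue_measure
           (fun l : R => F (Rad * l)%R))%E.

(* Main.v *)
Require Import Defs.
From HB Require Import structures.
From mathcomp Require Import all_boot all_order all_algebra.
From mathcomp Require Import all_classical all_reals all_analysis.
From mathcomp Require Import measurable_realfun ess_sup_inf ring lra.
Import Order.TTheory GRing.Theory Num.Theory.
Import numFieldNormedType.Exports.

(** The spectral projection on a window [S = S1 `*` S2] that contains the
    support of [F (sqrt l1, sqrt l2)] does all the work. If [|F| <= M] off a
    set without spectral mass, then the norm of [F(sqrt L1, sqrt L2) g] is at most [4 M]
    times the norm of [E(S) g] ([spec_integral_bound]), and [E(S)] acts as the
    tensor product of the one-parameter projections [E1(S1)] and [E2(S2)]. The
    one-parameter hypothesis, for the indicator of [[0, R_i]], bounds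
    [E_i(S_i) P_(B_i)] from [L^p_i] to [L^2] ([ST_projection_supported]). When a
    variable carries no ball, its exponent is [2] and the contractivity of
    [E_i] replaces this hypothesis.

    The bound for the tensor product ([tensor_bound]) is obtained by freezing
    one variable at a time. For a finite sum [u] of elementary tensors, the
    bound for [E1(S1)] holds on every slice at fixed [x2]; integrating it in
    [x2] leaves a norm [L^2(X2; L^p1(X1))] of [E2(S2) u], which Minkowski's
    integral inequality ([Lnorm_swap]; [p1 <= 2]) bounds by the norm
    [L^p1(X1; L^2(X2))]; the bound for [E2(S2)] on the slices at fixed [x1]
    finishes. Finite sums of tensors are dense in [L^2] of the product
    ([tensor_sum_dense]), and on [B1 `*` B2] the mixed norm is continuous for
    the [L^2] norm, because a ball has finite measure; so the bound extends to
    all functions. In the third estimate the tensor bound produces the norm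
    [L^2(X1; L^p2(X2))], and Minkowski's inequality gives the other order.

    The value [M] is the supremum of [|F|], so it remains to see that an
    essential supremum is good enough ([joint_sup_bound]). If suprema are taken
    up to Lebesgue null sets, the hypothesis applied to the indicator of a null
    set shows that [E_i] gives it no mass ([ST_null]). On an elementary tensor
    the joint spectral measure is the product of two scalar spectral measures,
    and Fubini's theorem carries the conclusion to null sets of the plane
    ([joint_null]).

    A spectral integral is given here through its quadratic form alone, so its
    norm is estimated by polarization, that is, by the numerical radius. This
    costs the factor [4], which is harmless since the constant of the theorem
    is free. *)

Set Implicit Arguments.
Unset Strict Implicit.
Unset Printing Implicit Defensive.

Local Open Scope classical_set_scope.
Local Open Scope ring_scope.


(** * Lebesgue norms of extended-real functions *)

Section Lnorm_ereal.
Context d (T : measurableType d) (R : realType) (mu : {measure set T -> \bar R}).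
Local Open Scope ereal_scope.
Implicit Types (f g : T -> \bar R) (p : R).

Lemma measurable_abs_poweR f p : measurable_fun [set: T] f ->
  measurable_fun [set: T] (fun x => `|f x| `^ p).
Proof.
move=> mf; apply: (@measurableT_comp _ _ _ _ _ _ (fun x => x `^ p)) => //=.
  exact: measurable_poweR.
exact: measurableT_comp.
Qed.

Lemma ae_le_Lnorm f g p : (0 <= p)%R -> measurable_fun [set: T] f ->
  measurable_fun [set: T] g -> (\forall x \ae mu, `|f x| <= `|g x|) ->
  'N[mu]_p%:E[f] <= 'N[mu]_p%:E[g].
Proof.
move=> p0 mf mg fg; rewrite unlock /=.
apply: gt0_ler_poweR; rewrite ?invr_ge0 ?in_itv/= ?andbT ?leey ?integral_ge0//.
- by move=> x _; exact: poweR_ge0.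
- by move=> x _; exact: poweR_ge0.
apply: ae_ge0_le_integral => //; do ?[exact: measurable_abs_poweR].
- by move=> x _; exact: poweR_ge0.
- by move=> x _; exact: poweR_ge0.
apply: filterS fg => x fgx _.
by apply: gt0_ler_poweR; rewrite ?in_itv/= ?andbT ?leey ?abse_ge0.
Qed.

Lemma le_Lnorm f g p : (0 <= p)%R -> measurable_fun [set: T] f ->
  measurable_fun [set: T] g -> (forall x, `|f x| <= `|g x|) ->
  'N[mu]_p%:E[f] <= 'N[mu]_p%:E[g].
Proof. by move=> p0 mf mg fg; apply: ae_le_Lnorm => //; exact: aeW. Qed.

Lemma ae_eq_Lnorm f g p : measurable_fun [set: T] f ->
  measurable_fun [set: T] g -> f = g %[ae mu] ->
  'N[mu]_p%:E[f] = 'N[mu]_p%:E[g].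
Proof.
move=> mf mg fg; rewrite unlock /=; congr (_ `^ _).
apply: ae_eq_integral => //; do ?[exact: measurable_abs_poweR].
by apply: filterS fg => x + _ => ->.
Qed.

Lemma LnormZl f p (c : R) : (0 <= c)%R -> p != 0%R -> measurable_fun [set: T] f ->
  'N[mu]_p%:E[(fun x => c%:E * f x)] = c%:E * 'N[mu]_p%:E[f].
Proof.
move=> c0 p0 mf; rewrite unlock /=.
under eq_integral do rewrite abseM poweRM// gee0_abs ?lee_fin//.
rewrite ge0_integralZl//; last 3 first.
- exact: measurable_abs_poweR.
- by move=> x _; exact: poweR_ge0.
- exact: poweR_ge0.
rewrite poweRM ?poweR_ge0//; last by apply: integral_ge0 => x _; exact: poweR_ge0.
by rewrite -poweRrM mulfV// poweRe1 ?lee_fin.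
Qed.

Lemma Lnorm_lty_ae_fin f p : p != 0%R -> measurable_fun [set: T] f ->
  'N[mu]_p%:E[f] < +oo -> \forall x \ae mu, f x \is a fin_num.
Proof.
move=> p0 mf Nf.
have : mu.-integrable setT (fun x => `|f x| `^ p).
  apply/integrableP; split; first exact: measurable_abs_poweR.
  under eq_integral do rewrite gee0_abs ?poweR_ge0//.
  by rewrite -poweR_Lnorm// poweR_lty.
move/integrable_ae => /(_ measurableT); apply: filterS => x /(_ I).
by case: (f x) => [r//| |]; rewrite [abse _]/abse poweRyr.
Qed.

(** The triangle inequality for real functions suffices: if both norms are
    finite then both functions are finite almost everywhere. *)
Lemma Lnorm_triangle f g p : (1 <= p)%R -> measurable_fun [set: T] f ->
  measurable_fun [set: T] g ->
  'N[mu]_p%:E[(fun x => f x + g x)] <= 'N[mu]_p%:E[f] + 'N[mu]_p%:E[g].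
Proof.
move=> p1 mf mg; have p0 : p != 0%R by rewrite gt_eqF// (lt_le_trans _ p1).
have [Nf|] := ltP 'N[mu]_p%:E[f] +oo; last first.
  rewrite leye_eq => /eqP ->; rewrite addye ?leey//.
  by rewrite -ltNye (lt_le_trans _ (Lnorm_ge0 _ _ _)).
have [Ng|] := ltP 'N[mu]_p%:E[g] +oo; last first.
  rewrite leye_eq => /eqP ->; rewrite addey ?leey//.
  by rewrite -ltNye (lt_le_trans _ (Lnorm_ge0 _ _ _)).
have mF h : measurable_fun [set: T] h -> measurable_fun setT (fine \o h : T -> R).
  by move=> mh; apply: measurableT_comp => //; exact: fine_measurable.
have fE : f = (EFin \o (fine \o f)) %[ae mu].
  by apply: filterS (Lnorm_lty_ae_fin p0 mf Nf) => x fx _/=; rewrite fineK.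
have gE : g = (EFin \o (fine \o g)) %[ae mu].
  by apply: filterS (Lnorm_lty_ae_fin p0 mg Ng) => x fx _/=; rewrite fineK.
rewrite (ae_eq_Lnorm _ _ _ fE)//; last exact/measurable_EFinP/mF.
rewrite (ae_eq_Lnorm _ _ _ gE)//; last exact/measurable_EFinP/mF.
apply: le_trans (minkowski_EFin mu (mF _ mf) (mF _ mg) p1).
rewrite le_eqVlt; apply/orP; left; apply/eqP; apply: ae_eq_Lnorm.
- exact: emeasurable_funD.
- by apply/measurable_EFinP/measurable_funD; exact: mF.
- by apply: filterS2 fE gE => x fE gE _ /=; rewrite {1}fE// {1}gE.
Qed.

End Lnorm_ereal.


Lemma poweR_mulB1 (R : realType) (x : \bar R) (q : R) : (0 <= x)%E -> 1 < q ->
  (x * x `^ (q - 1) = x `^ q)%E.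
Proof.
move=> x0 q1; have [->|xn0] := eqVneq x 0%E.
  by rewrite mul0e poweR0r// gt_eqF// (lt_trans _ q1).
rewrite -{1}(poweRe1 x0) -poweRD; first by rewrite addrC subrK.
by apply: nneg_neq0_poweRD_def => //; rewrite subr_ge0 ltW.
Qed.

Section ereal_hoelder.
Context d (T : measurableType d) (R : realType) (mu : {measure set T -> \bar R}).
Local Open Scope ereal_scope.
Implicit Types (f g : T -> \bar R) (p q : R).

Lemma integral_mul_eq0 f g p : (0 < p)%R -> measurable_fun [set: T] f ->
  measurable_fun [set: T] g -> 'N[mu]_p%:E[f] = 0 ->
  \int[mu]_x (f x * g x) = 0.
Proof.
move=> p0 mf mg /Lnorm_eq0_eq0 => /(_ mf); rewrite lte_fin => /(_ p0) f0.
rewrite (ae_eq_integral (cst 0))//; first by rewrite integral0.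
  exact: emeasurable_funM.
by apply: filterS f0 => x + _ => /(_ I) ->; rewrite mul0e.
Qed.

(** As for the triangle inequality, the case of two finite norms reduces to
    real functions. A vanishing norm is treated first, since the product of
    the norms is then [0] even if the other norm is infinite. *)
Lemma hoelder_ereal f g p q : (0 < p)%R -> (0 < q)%R -> (p^-1 + q^-1 = 1)%R ->
  measurable_fun [set: T] f -> measurable_fun [set: T] g ->
  (forall x, 0 <= f x) -> (forall x, 0 <= g x) ->
  \int[mu]_x (f x * g x) <= 'N[mu]_p%:E[f] * 'N[mu]_q%:E[g].
Proof.
move=> p0 q0 pq mf mg f0 g0.
have [Nf0|Nf0] := eqVneq 'N[mu]_p%:E[f] 0.
  by rewrite Nf0 mul0e (integral_mul_eq0 p0).
have [Ng0|Ng0] := eqVneq 'N[mu]_q%:E[g] 0.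
  rewrite Ng0 mule0; under eq_integral do rewrite muleC.
  by rewrite (integral_mul_eq0 q0).
have [Nf|] := ltP 'N[mu]_p%:E[f] +oo; last first.
  by rewrite leye_eq => /eqP ->; rewrite gt0_mulye ?leey// lt0e Ng0 Lnorm_ge0.
have [Ng|] := ltP 'N[mu]_q%:E[g] +oo; last first.
  by rewrite leye_eq => /eqP ->; rewrite gt0_muley ?leey// lt0e Nf0 Lnorm_ge0.
have mF h : measurable_fun [set: T] h -> measurable_fun [set: T] (fine \o h : T -> R).
  by move=> mh; apply: measurableT_comp => //; exact: fine_measurable.
have fE : f = (EFin \o (fine \o f)) %[ae mu].
  by apply: filterS (Lnorm_lty_ae_fin (lt0r_neq0 p0) mf Nf) => x fx _/=; rewrite fineK.
have gE : g = (EFin \o (fine \o g)) %[ae mu].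
  by apply: filterS (Lnorm_lty_ae_fin (lt0r_neq0 q0) mg Ng) => x fx _/=; rewrite fineK.
rewrite (ae_eq_Lnorm _ _ _ fE)//; last exact/measurable_EFinP/mF.
rewrite (ae_eq_Lnorm _ _ _ gE)//; last exact/measurable_EFinP/mF.
apply: le_trans (hoelder mu (mF _ mf) (mF _ mg) p0 q0 pq).
rewrite Lnorm1 le_eqVlt; apply/orP; left; apply/eqP; apply: ae_eq_integral => //.
- exact: emeasurable_funM.
- by apply/measurableT_comp/measurable_EFinP/measurable_funM => //; exact: mF.
- apply: filterS2 fE gE => x fE gE _ /=; rewrite {1}fE// {1}gE//=.
  by rewrite ger0_norm// mulr_ge0// fine_ge0.
Qed.

(** Hoelder's inequality for [|f|^p] and the indicator of [B], with the
    exponent [2 / p] and its conjugate. The constant is a power of [mu B]; only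
    its finiteness matters, as it makes the [L^p] norm continuous for the [L^2]
    norm. *)
Lemma Lnorm_le_L2 p (B : set T) : (1 <= p <= 2)%R -> measurable B -> mu B < +oo ->
  exists2 K : R, (0 <= K)%R & forall f, measurable_fun [set: T] f ->
    (forall x, ~ B x -> f x = 0) -> 'N[mu]_p%:E[f] <= K%:E * 'N[mu]_2%:E[f].
Proof.
move=> /andP[p1]; rewrite le_eqVlt => /predU1P[->|p2] mB muB.
  by exists 1%R => // f mf _; rewrite mul1e.
have p0 : (0 < p)%R by rewrite (lt_le_trans _ p1).
have pn0 : p != 0%R by rewrite gt_eqF.
pose a : R := (2 / p)%R; pose b : R := (1 - p / 2)^-1%R.
have a0 : (0 < a)%R by rewrite divr_gt0.
have b1 : (0 < 1 - p / 2)%R by rewrite subr_gt0 ltr_pdivrMr// mul1r.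
have b0 : (0 < b)%R by rewrite invr_gt0.
have ab : (a^-1 + b^-1 = 1)%R by rewrite invf_div invrK addrC subrK.
have [m mE] : exists m : R, mu B = m%:E.
  by exists (fine (mu B)); rewrite fineK// ge0_fin_numE.
have m0 : (0 <= m)%R by rewrite -lee_fin -mE.
exists ((m `^ b^-1) `^ p^-1)%R => [|f mf fB]; first exact: powR_ge0.
have -> : 'N[mu]_p%:E[f] = (\int[mu]_x (`|f x| `^ p)) `^ p^-1 by rewrite unlock.
have H : \int[mu]_x (`|f x| `^ p) <= ('N[mu]_2%:E[f]) `^ p * (m `^ b^-1)%:E.
  have -> : \int[mu]_x (`|f x| `^ p) = \int[mu]_x (`|f x| `^ p * (\1_B x)%:E).
    apply: eq_integral => x _; rewrite indicE; have [xB|] := boolP (x \in B).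
      by rewrite mule1.
    by rewrite notin_setE => /fB ->; rewrite abse0 poweR0r// mul0e.
  apply: le_trans (@hoelder_ereal _ _ a b a0 b0 ab _ _ _ _) _.
  - exact: measurable_abs_poweR.
  - exact/measurable_EFinP/measurable_indic.
  - by move=> x; exact: poweR_ge0.
  - by move=> x; rewrite lee_fin.
  rewrite le_eqVlt; apply/orP; left; apply/eqP; congr (_ * _).
    rewrite ![in LHS]unlock ![in RHS]unlock -poweRrM.
    rewrite [in RHS]mulrC /a invf_div; congr (_ `^ _).
    apply: eq_integral => x _; rewrite gee0_abs ?poweR_ge0// -poweRrM.
    by rewrite mulrC divfK.
  rewrite unlock -poweR_EFin -mE; congr (_ `^ _).
  rewrite -[B in RHS]setIT -integral_indic//; apply: eq_integral => x _.
  by rewrite indicE; case: (x \in B); rewrite ?abse0 ?poweR0r ?gt_eqF// abse1 poweR1r.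
apply: (@le_trans _ _ (('N[mu]_2%:E[f] `^ p * (m `^ b^-1)%:E) `^ p^-1)).
  apply: gt0_ler_poweR => //; first by rewrite invr_ge0 ltW.
    by rewrite in_itv/= leey andbT; apply: integral_ge0 => x _; exact: poweR_ge0.
  by rewrite in_itv/= leey andbT mule_ge0 ?poweR_ge0 ?lee_fin ?powR_ge0.
rewrite poweRM ?poweR_ge0 ?lee_fin ?powR_ge0// -poweRrM mulfV// poweRe1 ?Lnorm_ge0//.
by rewrite muleC poweR_EFin.
Qed.

End ereal_hoelder.

(** * Minkowski's integral inequality *)

Section minkowski_integral.
Context d1 d2 (T1 : measurableType d1) (T2 : measurableType d2) (R : realType).
Variables (mu1 : {sigma_finite_measure set T1 -> \bar R})
  (mu2 : {sigma_finite_measure set T2 -> \bar R}).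
Local Open Scope ereal_scope.

Lemma measurable_slice1 d3 (T3 : measurableType d3) (h : T1 * T2 -> T3) x :
  measurable_fun [set: T1 * T2] h -> measurable_fun [set: T2] (fun y => h (x, y)).
Proof. by move=> mh; apply: measurableT_comp. Qed.

Lemma measurable_slice2 d3 (T3 : measurableType d3) (h : T1 * T2 -> T3) y :
  measurable_fun [set: T1 * T2] h -> measurable_fun [set: T1] (fun x => h (x, y)).
Proof. by move=> mh; apply: measurableT_comp. Qed.

Lemma measurable_Lnorm_slice1 (h : T1 * T2 -> \bar R) (p : R) :
  measurable_fun [set: T1 * T2] h ->
  measurable_fun [set: T1] (fun x => 'N[mu2]_p%:E[(fun y => h (x, y))]).
Proof.
move=> mh; rewrite unlock/=.
apply: (@measurableT_comp _ _ _ _ _ _ (fun x => x `^ p^-1)) => //=.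
  exact: measurable_poweR.
apply: (measurable_fun_fubini_tonelli_F (fun z => `|h z| `^ p)).
  exact: measurable_abs_poweR.
by move=> z; exact: poweR_ge0.
Qed.

Lemma measurable_Lnorm_slice2 (h : T1 * T2 -> \bar R) (p : R) :
  measurable_fun [set: T1 * T2] h ->
  measurable_fun [set: T2] (fun y => 'N[mu1]_p%:E[(fun x => h (x, y))]).
Proof.
move=> mh; rewrite unlock/=.
apply: (@measurableT_comp _ _ _ _ _ _ (fun x => x `^ p^-1)) => //=.
  exact: measurable_poweR.
apply: (measurable_fun_fubini_tonelli_G (fun z => `|h z| `^ p)).
  exact: measurable_abs_poweR.
by move=> z; exact: poweR_ge0.
Qed.

(** With [G y] the integral of [F (x, y)] in [x], write [G^q = G * G^(q-1)],
    exchange the integrals and apply Hoelder's inequality in [y]. A power of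
    the norm of [G] cancels, which is where its finiteness is used. *)
Lemma minkowski_integral (F : T1 * T2 -> \bar R) (q : R) : (1 <= q)%R ->
  measurable_fun [set: T1 * T2] F -> (forall z, 0 <= F z) ->
  'N[mu2]_q%:E[(fun y => \int[mu1]_x F (x, y))] < +oo ->
  'N[mu2]_q%:E[(fun y => \int[mu1]_x F (x, y))] <=
  \int[mu1]_x 'N[mu2]_q%:E[(fun y => F (x, y))].
Proof.
move=> + mF F0; have G0 y : 0 <= \int[mu1]_x F (x, y) by exact: integral_ge0.
have mG : measurable_fun [set: T2] (fun y => \int[mu1]_x F (x, y)).
  by apply: (measurable_fun_fubini_tonelli_G F).
rewrite le_eqVlt => /predU1P[<- _|q1 Nfin].
  rewrite Lnorm1; under eq_integral do rewrite gee0_abs//.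
  under [leRHS]eq_integral do rewrite Lnorm1.
  rewrite -fubini_tonelli// le_eqVlt; apply/orP; left; apply/eqP.
  by apply: eq_integral => x _; apply: eq_integral => y _; rewrite gee0_abs.
set G := fun y => _; set N := 'N[mu2]_q%:E[G].
have q0 : (0 < q)%R by rewrite (lt_trans _ q1).
have qn0 : q != 0%R by rewrite gt_eqF.
have q10 : (0 < q - 1)%R by rewrite subr_gt0.
have q1n0 : (q - 1)%R != 0%R by rewrite gt_eqF.
have [->|N0] := eqVneq N 0; first by apply: integral_ge0 => x _; exact: Lnorm_ge0.
have Npos : 0 < N by rewrite lt0e N0 Lnorm_ge0.
pose b : R := (q / (q - 1))%R.
have b0 : (0 < b)%R by rewrite divr_gt0.
have qb : (q^-1 + b^-1 = 1)%R by rewrite invf_div; field.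
have NGb : 'N[mu2]_b%:E[(fun y => G y `^ (q - 1))] = N `^ (q - 1).
  rewrite /N ![in LHS]unlock ![in RHS]unlock -poweRrM invf_div.
  rewrite [(q^-1 * _)%R]mulrC; congr (_ `^ _).
  apply: eq_integral => y _; rewrite !gee0_abs ?poweR_ge0 ?G0// -poweRrM.
  by rewrite [(_ * b)%R]mulrC divfK.
have key : N `^ q <= (\int[mu1]_x 'N[mu2]_q%:E[(fun y => F (x, y))]) * N `^ (q - 1).
  rewrite poweR_Lnorm//.
  have -> : \int[mu2]_y (`|G y| `^ q) =
      \int[mu2]_y \int[mu1]_x (F (x, y) * G y `^ (q - 1)).
    apply: eq_integral => y _; rewrite gee0_abs ?G0// ge0_integralZr//; last 2 first.
    - exact: measurable_slice2.
    - exact: poweR_ge0.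
    by rewrite poweR_mulB1.
  have mFG : measurable_fun [set: T1 * T2] (fun z => F z * G z.2 `^ (q - 1)).
    apply: emeasurable_funM => //.
    apply: (@measurableT_comp _ _ _ _ _ _ (fun x => x `^ (q - 1))) => //=.
      exact: measurable_poweR.
    by apply: (measurableT_comp mG); exact: measurable_snd.
  rewrite -(fubini_tonelli _ mFG); last first.
    by move=> z; rewrite mule_ge0// poweR_ge0.
  rewrite -NGb -ge0_integralZr//;
    do ?[exact: measurable_Lnorm_slice1|exact: Lnorm_ge0
        |by move=> x _; exact: Lnorm_ge0].
  apply: ge0_le_integral => //.
  - by move=> x _; apply: integral_ge0 => y _; rewrite mule_ge0// poweR_ge0.
  - apply: (measurable_fun_fubini_tonelli_F _ mFG) => z.
    by rewrite mule_ge0// poweR_ge0.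
  - by apply: emeasurable_funM => //; exact: measurable_Lnorm_slice1.
  - move=> x _; apply: hoelder_ereal => //.
    + exact: measurable_slice1.
    + apply: (@measurableT_comp _ _ _ _ _ _ (fun x => x `^ (q - 1))) => //=.
      exact: measurable_poweR.
    + by move=> y; exact: poweR_ge0.
have Nfn : N \is a fin_num by rewrite ge0_fin_numE// Lnorm_ge0.
have NqE : N `^ q = N * N `^ (q - 1).
  by rewrite poweR_mulB1// Lnorm_ge0.
move: key; rewrite NqE lee_pmul2r//; first exact: fin_num_poweR.
exact: poweR_gt0.
Qed.

(** Minkowski's integral inequality with the exponent [2 / p], applied to
    [|h|^p]. *)
Lemma Lnorm_swap (h : T1 * T2 -> \bar R) (p : R) : (1 <= p <= 2)%R ->
  measurable_fun [set: T1 * T2] h ->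
  'N[mu2]_2%:E[(fun y => 'N[mu1]_p%:E[(fun x => h (x, y))])] < +oo ->
  'N[mu2]_2%:E[(fun y => 'N[mu1]_p%:E[(fun x => h (x, y))])] <=
  'N[mu1]_p%:E[(fun x => 'N[mu2]_2%:E[(fun y => h (x, y))])].
Proof.
move=> /andP[p1 p2] mh.
have p0 : (0 < p)%R by rewrite (lt_le_trans _ p1).
have pn0 : p != 0%R by rewrite gt_eqF.
pose F z := `|h z| `^ p; pose q : R := (2 / p)%R.
have q1 : (1 <= q)%R by rewrite ler_pdivlMr// mul1r.
have q0 : q != 0%R by rewrite gt_eqF// (lt_le_trans _ q1).
have LE : 'N[mu2]_2%:E[(fun y => 'N[mu1]_p%:E[(fun x => h (x, y))])] =
   ('N[mu2]_q%:E[(fun y => \int[mu1]_x F (x, y))]) `^ p^-1.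
  rewrite ![in LHS]unlock ![in RHS]unlock -poweRrM.
  have -> : (q^-1 * p^-1 = 2^-1 :> R)%R by rewrite invf_div; field.
  congr (_ `^ _); apply: eq_integral => y _.
  rewrite gee0_abs ?poweR_ge0// gee0_abs; last first.
    by apply: integral_ge0 => x _; exact: poweR_ge0.
  by rewrite -poweRrM mulrC.
have RE : 'N[mu1]_p%:E[(fun x => 'N[mu2]_2%:E[(fun y => h (x, y))])] =
   (\int[mu1]_x 'N[mu2]_q%:E[(fun y => F (x, y))]) `^ p^-1.
  rewrite ![in LHS]unlock ![in RHS]unlock; congr (_ `^ _); apply: eq_integral => x _.
  rewrite gee0_abs ?poweR_ge0// -poweRrM.
  have -> : (2^-1 * p = q^-1 :> R)%R by rewrite invf_div mulrC.
  congr (_ `^ _); apply: eq_integral => y _.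
  by rewrite /F [in RHS]gee0_abs ?poweR_ge0// -poweRrM mulrC divfK.
rewrite LE RE => fin; apply: gt0_ler_poweR.
- by rewrite invr_ge0 ltW.
- by rewrite in_itv/= leey Lnorm_ge0.
- by rewrite in_itv/= leey andbT; apply: integral_ge0 => x _; exact: Lnorm_ge0.
apply: minkowski_integral => //.
- exact: measurable_abs_poweR.
- by move=> z; exact: poweR_ge0.
- by apply: lty_poweRy fin; rewrite invr_eq0.
Qed.

Lemma Lnorm2_prod1 (h : T1 * T2 -> \bar R) : measurable_fun [set: T1 * T2] h ->
  'N[(mu1 \x mu2)%E]_2%:E[h] =
  'N[mu1]_2%:E[(fun x => 'N[mu2]_2%:E[(fun y => h (x, y))])].
Proof.
move=> mh; rewrite ![in LHS]unlock ![in RHS]unlock; congr (_ `^ _).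
rewrite fubini_tonelli1/=; last 2 first.
- exact: measurable_abs_poweR.
- by move=> z; exact: poweR_ge0.
apply: eq_integral => x _; rewrite gee0_abs ?poweR_ge0// -poweRrM mulVf//.
by rewrite poweRe1//; apply: integral_ge0 => y _; exact: poweR_ge0.
Qed.

Lemma Lnorm2_prod2 (h : T1 * T2 -> \bar R) : measurable_fun [set: T1 * T2] h ->
  'N[(mu1 \x mu2)%E]_2%:E[h] =
  'N[mu2]_2%:E[(fun y => 'N[mu1]_2%:E[(fun x => h (x, y))])].
Proof.
move=> mh; rewrite ![in LHS]unlock ![in RHS]unlock; congr (_ `^ _).
rewrite fubini_tonelli2/=; last 2 first.
- exact: measurable_abs_poweR.
- by move=> z; exact: poweR_ge0.
apply: eq_integral => y _; rewrite gee0_abs ?poweR_ge0// -poweRrM mulVf//.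
by rewrite poweRe1//; apply: integral_ge0 => x _; exact: poweR_ge0.
Qed.

End minkowski_integral.


(** * Complex-valued functions *)

Section complex_pointwise.
Context (R : realType).
Implicit Types z w : R[i].

Lemma normcE2 z : Normc.normc z ^+ 2 = complex.Re z ^+ 2 + complex.Im z ^+ 2.
Proof. by case: z => a b; rewrite sqr_sqrtr// addr_ge0// sqr_ge0. Qed.

Lemma normc_ge0 z : 0 <= Normc.normc z.
Proof. by case: z => a b; exact: sqrtr_ge0. Qed.

Lemma norm_Re_normc z : `|complex.Re z| <= Normc.normc z.
Proof.
rewrite -[X in X <= _]sqrtr_sqr; case: z => a b /=.
by rewrite ler_wsqrtr// lerDl sqr_ge0.
Qed.

Lemma norm_Im_normc z : `|complex.Im z| <= Normc.normc z.
Proof.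
rewrite -[X in X <= _]sqrtr_sqr; case: z => a b /=.
by rewrite ler_wsqrtr// lerDr sqr_ge0.
Qed.

Lemma normcJ z : Normc.normc (conjc z) = Normc.normc z.
Proof. by case: z => a b /=; rewrite sqrrN. Qed.

Lemma normc_real (a : R) : Normc.normc (Complex a 0) = `|a|.
Proof. by rewrite /= expr0n addr0 sqrtr_sqr. Qed.

Lemma cReD z w : complex.Re (z + w) = complex.Re z + complex.Re w.
Proof. by case: z => a b; case: w. Qed.
Lemma cImD z w : complex.Im (z + w) = complex.Im z + complex.Im w.
Proof. by case: z => a b; case: w. Qed.
Lemma cReM z w : complex.Re (z * w) =
  complex.Re z * complex.Re w - complex.Im z * complex.Im w.
Proof. by case: z => a b; case: w. Qed.
Lemma cImM z w : complex.Im (z * w) =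
  complex.Re z * complex.Im w + complex.Im z * complex.Re w.
Proof. by case: z => a b; case: w. Qed.

End complex_pointwise.

Lemma measurable_sqrt (R : realType) : measurable_fun [set: R] (@Num.sqrt R).
Proof. by apply: continuous_measurable_fun; exact: sqrt_continuous. Qed.

Section complex_measurable.
Context d (T : measurableType d) (R : realType).
Implicit Types (f g : T -> R[i]).

Lemma cmeasurableD f g : cmeasurable f -> cmeasurable g ->
  cmeasurable (fun x => f x + g x).
Proof.
move=> [fr fi] [gr gi]; split.
  by under eq_fun do rewrite cReD; exact: measurable_funD.
by under eq_fun do rewrite cImD; exact: measurable_funD.
Qed.

Lemma cmeasurableM f g : cmeasurable f -> cmeasurable g ->
  cmeasurable (fun x => f x * g x).
Proof.
move=> [fr fi] [gr gi]; split.
  by under eq_fun do rewrite cReM; apply: measurable_funB; exact: measurable_funM.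
by under eq_fun do rewrite cImM; apply: measurable_funD; exact: measurable_funM.
Qed.

Lemma cmeasurable_cst (c : R[i]) : cmeasurable (fun _ : T => c).
Proof. by split; exact: measurable_cst. Qed.

Lemma cmeasurable_lin (c : R[i]) f g : cmeasurable f -> cmeasurable g ->
  cmeasurable (fun x => c * f x + g x).
Proof.
by move=> mf mg; apply: cmeasurableD => //; apply: cmeasurableM => //;
  exact: cmeasurable_cst.
Qed.

Lemma cmeasurable_patch (B : set T) f : measurable B -> cmeasurable f ->
  cmeasurable (patch (fun=> 0%R) B f).
Proof.
move=> mB mf.
have -> : patch (fun=> 0) B f = fun x => Complex (\1_B x) 0 * f x.
  apply/funext => x; rewrite /patch indicE; case: (x \in B); case: (f x) => a b.
    by apply/eqP; rewrite eq_complex/= !mul0r !mul1r subr0 addr0 !eqxx.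
  by apply/eqP; rewrite eq_complex/= !mul0r subr0 addr0 !eqxx.
apply: cmeasurableM => //; split => /=; last exact: measurable_cst.
exact: measurable_indic.
Qed.

Lemma measurable_normc f : cmeasurable f ->
  measurable_fun [set: T] (fun x => Normc.normc (f x)).
Proof.
move=> [fr fi].
have -> : (fun x => Normc.normc (f x)) =
  (fun x => Num.sqrt (complex.Re (f x) ^+ 2 + complex.Im (f x) ^+ 2)).
  by apply/funext => x; case: (f x).
apply: (@measurableT_comp _ _ _ _ _ _ (@Num.sqrt R)) => /=.
  exact: measurable_sqrt.
by apply: measurable_funD; exact: measurable_funX.
Qed.

Lemma measurable_cabs f : cmeasurable f -> measurable_fun [set: T] (cabs f).
Proof. by move=> mf; apply/measurable_EFinP; exact: measurable_normc. Qed.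

Lemma cabs_ge0 f x : (0 <= cabs f x)%E.
Proof. by rewrite lee_fin normc_ge0. Qed.

Lemma abse_cabs f x : `|cabs f x|%E = cabs f x.
Proof. by rewrite gee0_abs// cabs_ge0. Qed.

End complex_measurable.

Lemma cmeasurable_comp d d' (T : measurableType d) (T' : measurableType d')
    (R : realType) (f : T' -> R[i]) (h : T -> T') :
  cmeasurable f -> measurable_fun [set: T] h -> cmeasurable (fun x => f (h x)).
Proof.
by move=> [fr fi] mh; split; [exact: (measurableT_comp fr)|
                              exact: (measurableT_comp fi)].
Qed.

Section complex_Lnorm.
Context d (T : measurableType d) (R : realType) (mu : {measure set T -> \bar R}).
Implicit Types (f g : T -> R[i]) (p : R).

Lemma cLnorm_ge0 (p : \bar R) f : (0 <= cLnorm mu p f)%E.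
Proof. exact: Lnorm_ge0. Qed.

Lemma ae_eq_cLnorm f g p : cmeasurable f -> cmeasurable g -> f = g %[ae mu] ->
  cLnorm mu p%:E f = cLnorm mu p%:E g.
Proof.
move=> mf mg fg; apply: ae_eq_Lnorm; do ?exact: measurable_cabs.
by apply: filterS fg => x + _ => /(_ I); rewrite /cabs => ->.
Qed.

Lemma ae_le_cLnorm f g p : 0 <= p -> cmeasurable f -> cmeasurable g ->
  (\forall x \ae mu, Normc.normc (f x) <= Normc.normc (g x)) ->
  (cLnorm mu p%:E f <= cLnorm mu p%:E g)%E.
Proof.
move=> p0 mf mg fg; apply: ae_le_Lnorm => //; do ?exact: measurable_cabs.
by apply: filterS fg => x; rewrite !abse_cabs lee_fin.
Qed.

Lemma le_cLnorm f g p : 0 <= p -> cmeasurable f -> cmeasurable g ->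
  (forall x, Normc.normc (f x) <= Normc.normc (g x)) ->
  (cLnorm mu p%:E f <= cLnorm mu p%:E g)%E.
Proof. by move=> p0 mf mg fg; apply: ae_le_cLnorm => //; exact: aeW. Qed.

Lemma cLnormD f g p : 1 <= p -> cmeasurable f -> cmeasurable g ->
  (cLnorm mu p%:E (fun x => (f x + g x)%R) <= cLnorm mu p%:E f + cLnorm mu p%:E g)%E.
Proof.
move=> p1 mf mg.
apply: le_trans (Lnorm_triangle mu p1 (measurable_cabs mf) (measurable_cabs mg)).
apply: le_Lnorm; first by rewrite (le_trans _ p1).
- by apply: measurable_cabs; exact: cmeasurableD.
- by apply: emeasurable_funD; exact: measurable_cabs.
move=> x; rewrite !gee0_abs ?adde_ge0 ?cabs_ge0//.
by rewrite -EFinD lee_fin le_normcD.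
Qed.

Lemma cLnormZ (c : R[i]) f p : p != 0 -> cmeasurable f ->
  (cLnorm mu p%:E (fun x => (c * f x)%R) = (Normc.normc c)%:E * cLnorm mu p%:E f)%E.
Proof.
move=> p0 mf; rewrite -LnormZl ?normc_ge0//; last exact: measurable_cabs.
by apply: eq_Lnorm => x; rewrite /cabs Normc.normcM EFinM.
Qed.

Lemma cLnorm0 p : p != 0 -> cLnorm mu p%:E (fun=> 0) = 0%E.
Proof.
move=> p0; rewrite -[RHS](@Lnorm0 _ _ _ mu p%:E)//.
by apply: eq_Lnorm => x; rewrite /cabs Normc.normc0.
Qed.

Lemma cLnorm_patch p (B : set T) f : 0 <= p -> measurable B -> cmeasurable f ->
  (cLnorm mu p%:E (patch (fun=> 0%R) B f) <= cLnorm mu p%:E f)%E.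
Proof.
move=> p0 mB mf; apply: le_cLnorm => //; first exact: cmeasurable_patch.
move=> x; rewrite /patch; case: (x \in B) => //.
by rewrite Normc.normc0 normc_ge0.
Qed.

Lemma cLnorm_eq0 f p : 0 < p -> cmeasurable f -> cLnorm mu p%:E f = 0%E ->
  f = (fun=> 0) %[ae mu].
Proof.
move=> p0 mf /Lnorm_eq0_eq0 => /(_ (measurable_cabs mf)); rewrite lte_fin => /(_ p0).
apply: filterS => x + _ => /(_ I) [].
exact: Normc.eq0_normc.
Qed.

End complex_Lnorm.

(** * The space of square integrable functions *)

Section L2.
Context d (T : measurableType d) (R : realType) (mu : {measure set T -> \bar R}).
Implicit Types (f g h : T -> R[i]).

(** A real number, so that the algebra of norms is not encumbered with
    infinities; it is the norm only on [cL2], as [fine] sends [+oo] to [0]. *)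
Definition l2 f : R := fine (cLnorm mu 2%:E f).

Lemma cL2E f : cL2 mu f -> cLnorm mu 2%:E f = (l2 f)%:E.
Proof. by move=> [_ fo]; rewrite fineK// ge0_fin_numE// cLnorm_ge0. Qed.

Lemma l2_ge0 f : 0 <= l2 f.
Proof. by rewrite fine_ge0// cLnorm_ge0. Qed.

Lemma cL2D f g : cL2 mu f -> cL2 mu g -> cL2 mu (fun x => f x + g x).
Proof.
move=> [mf fo] [mg go]; split; first exact: cmeasurableD.
by apply: le_lt_trans (cLnormD _ _ _ _) _ => //; [rewrite ler1n|exact: lte_add_pinfty].
Qed.

Lemma cL2Z (c : R[i]) f : cL2 mu f -> cL2 mu (fun x => c * f x).
Proof.
move=> [mf fo]; split; first by apply: cmeasurableM => //; exact: cmeasurable_cst.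
by rewrite cLnormZ// lte_mul_pinfty ?lee_fin ?normc_ge0.
Qed.

Lemma cL2_lin (c : R[i]) f g : cL2 mu f -> cL2 mu g -> cL2 mu (fun x => c * f x + g x).
Proof. by move=> fL gL; apply: cL2D => //; exact: cL2Z. Qed.

Lemma cL2_0 : cL2 mu (fun=> 0).
Proof. by split; [exact: cmeasurable_cst|rewrite cLnorm0]. Qed.

Lemma cL2B f g : cL2 mu f -> cL2 mu g -> cL2 mu (fun x => f x - g x).
Proof.
move=> fL gL; have -> : (fun x => f x - g x) = (fun x => -1 * g x + f x).
  by apply/funext => x; rewrite mulN1r addrC.
exact: cL2_lin.
Qed.

Lemma cL2_patch (B : set T) f : measurable B -> cL2 mu f -> cL2 mu (patch (fun=> 0%R) B f).
Proof.
move=> mB [mf fo]; split; first exact: cmeasurable_patch.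
by apply: le_lt_trans fo; exact: cLnorm_patch.
Qed.

Lemma cL2_le f g : cmeasurable f -> cL2 mu g ->
  (forall x, Normc.normc (f x) <= Normc.normc (g x)) -> cL2 mu f.
Proof. by move=> mf [mg go] fg; split => //; apply: le_lt_trans go; exact: le_cLnorm. Qed.

Lemma l2D f g : cL2 mu f -> cL2 mu g -> l2 (fun x => f x + g x) <= l2 f + l2 g.
Proof.
move=> fL gL; rewrite -lee_fin EFinD -!cL2E//; last exact: cL2D.
by apply: cLnormD; [rewrite ler1n|case: fL|case: gL].
Qed.

Lemma l2Z (c : R[i]) f : cL2 mu f -> l2 (fun x => c * f x) = Normc.normc c * l2 f.
Proof. by move=> fL; rewrite /l2 cLnormZ//; [rewrite fineM// cL2E|case: fL]. Qed.

Lemma l2BC f g : cL2 mu f -> cL2 mu g -> l2 (fun x => f x - g x) = l2 (fun x => g x - f x).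
Proof.
move=> fL gL; have -> : (fun x => f x - g x) = (fun x => -1 * (g x - f x)).
  by apply/funext => x; rewrite mulN1r opprB.
by rewrite l2Z ?normcN ?Normc.normc1 ?mul1r//; exact: cL2B.
Qed.

Lemma l2_sub_triangle f g : cL2 mu f -> cL2 mu g -> l2 f <= l2 g + l2 (fun x => f x - g x).
Proof.
move=> fL gL; apply: le_trans (l2D gL (cL2B fL gL)).
by under eq_fun do rewrite addrC subrK.
Qed.

Lemma ae_eq_l2 f g : cL2 mu f -> cL2 mu g -> f = g %[ae mu] -> l2 f = l2 g.
Proof. by move=> [mf _] [mg _] fg; rewrite /l2 (ae_eq_cLnorm _ mf mg fg). Qed.

Lemma l2_eq0 f : cL2 mu f -> l2 f = 0 -> f = (fun=> 0) %[ae mu].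
Proof. by move=> fL f0; apply: (@cLnorm_eq0 _ _ _ _ _ 2); [|case: fL|rewrite cL2E// f0]. Qed.

(** The real inner product. It determines the complex one ([Im_inner]) and is
    bilinear over the reals, which spares conjugates in the computations. *)
Definition rin f g : R := complex.Re (inner mu f g).

Definition dot f g x : R :=
  complex.Re (f x) * complex.Re (g x) + complex.Im (f x) * complex.Im (g x).

Lemma rinE f g : rin f g = fine (\int[mu]_x (dot f g x)%:E).
Proof.
rewrite /rin /=; congr fine; apply: eq_integral => x _; congr EFin.
by rewrite /dot; case: (f x) => a b; case: (g x) => a' b'/=; rewrite mulrN opprK.
Qed.

Lemma Im_inner f g : complex.Im (inner mu f g) = rin f (fun x => 'i%C * g x).
Proof.
rewrite rinE /=; congr fine; apply: eq_integral => x _; congr EFin.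
by rewrite /dot; case: (f x) => a b; case: (g x) => a' b'/=; ring.
Qed.

Lemma norm_dot f g x : `|dot f g x| <= Normc.normc (f x) * Normc.normc (g x).
Proof.
have -> : dot f g x = complex.Re (f x * conjc (g x)).
  by rewrite /dot; case: (f x) => a b; case: (g x) => a' b'/=; rewrite mulrN opprK.
by apply: le_trans (norm_Re_normc _) _; rewrite Normc.normcM normcJ.
Qed.

Lemma measurable_dot f g : cmeasurable f -> cmeasurable g ->
  measurable_fun [set: T] (dot f g).
Proof.
by move=> [fr fi] [gr gi]; apply: measurable_funD; exact: measurable_funM.
Qed.

Lemma integral_normcM f g : cL2 mu f -> cL2 mu g ->
  (\int[mu]_x (cabs f x * cabs g x) <= (l2 f * l2 g)%:E)%E.
Proof.
move=> fL gL; rewrite EFinM -!cL2E//.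
apply: hoelder_ereal => //; try exact: cabs_ge0.
- by rewrite [RHS](splitr 1) mul1r.
- by apply: measurable_cabs; case: fL.
- by apply: measurable_cabs; case: gL.
Qed.

Lemma integrable_dot f g : cL2 mu f -> cL2 mu g ->
  mu.-integrable setT (EFin \o dot f g).
Proof.
move=> fL gL; have [mf _] := fL; have [mg _] := gL.
apply/integrableP; split; first by apply/measurable_EFinP; exact: measurable_dot.
apply: (@le_lt_trans _ _ (l2 f * l2 g)%:E); last exact: ltry.
apply: le_trans (integral_normcM fL gL); apply: ge0_le_integral => //.
- by apply/measurableT_comp/measurable_EFinP; [|exact: measurable_dot].
- by apply: emeasurable_funM; exact: measurable_cabs.
- by move=> x _; rewrite -EFinM lee_fin norm_dot.
Qed.

(** Integrability comes first ([integrable_dot]): without it the real part of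
    the inner product would be a meaningless default value. *)
Lemma rin_cauchy_schwarz f g : cL2 mu f -> cL2 mu g -> `|rin f g| <= l2 f * l2 g.
Proof.
move=> fL gL; rewrite rinE; have [mf _] := fL; have [mg _] := gL.
have ifg := integrable_dot fL gL.
apply: le_trans (le_normr_Rintegral _ ifg) _ => //.
rewrite -lee_fin; apply: le_trans (integral_normcM fL gL).
rewrite /Rintegral fineK; last first.
  by apply: integrable_fin_num => //; exact: integrable_norm.
apply: ge0_le_integral => //.
- by apply/measurable_EFinP/measurableT_comp => //; exact: measurable_dot.
- by apply: emeasurable_funM; exact: measurable_cabs.
- by move=> x _; rewrite -EFinM lee_fin norm_dot.
Qed.

Lemma rinC f g : rin f g = rin g f.
Proof.
rewrite !rinE; congr fine; apply: eq_integral => x _; congr EFin.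
by rewrite /dot mulrC [X in _ + X]mulrC.
Qed.

Lemma rinDl f g h : cL2 mu f -> cL2 mu g -> cL2 mu h ->
  rin (fun x => f x + g x) h = rin f h + rin g h.
Proof.
move=> fL gL hL; rewrite !rinE -RintegralD//; try exact: integrable_dot.
by congr fine; apply: eq_integral => x _; congr EFin; rewrite /dot cReD cImD/=; ring.
Qed.

Lemma rinZl (a : R) f h : cL2 mu f -> cL2 mu h ->
  rin (fun x => Complex a 0 * f x) h = a * rin f h.
Proof.
move=> fL hL; rewrite !rinE -RintegralZl//; last exact: integrable_dot.
by congr fine; apply: eq_integral => x _; congr EFin; rewrite /dot cReM cImM/=; ring.
Qed.

Lemma rinZr (a : R) f h : cL2 mu f -> cL2 mu h ->
  rin h (fun x => Complex a 0 * f x) = a * rin h f.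
Proof. by move=> fL hL; rewrite rinC rinZl// [rin f h]rinC. Qed.

Lemma rin_ii f g : rin (fun x => 'i%C * f x) (fun x => 'i%C * g x) = rin f g.
Proof.
rewrite !rinE; congr fine; apply: eq_integral => x _; congr EFin.
by rewrite /dot !cReM !cImM/=; ring.
Qed.

Lemma ae_eq_rin f f' g : cL2 mu f -> cL2 mu f' -> cL2 mu g ->
  f = f' %[ae mu] -> rin f g = rin f' g.
Proof.
move=> [mf _] [mf' _] [mg _] ff'; rewrite !rinE; congr fine.
apply: ae_eq_integral => //; do ?[by apply/measurable_EFinP; exact: measurable_dot].
by apply: filterS ff' => x + _ => /(_ I); rewrite /dot => ->.
Qed.

Lemma l2_sqr f : cL2 mu f -> l2 f ^+ 2 = rin f f.
Proof.
move=> fL; rewrite rinE /l2 -powR_mulrn ?l2_ge0// -fine_poweR; congr fine.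
rewrite poweR_Lnorm//; apply: eq_integral => x _.
by rewrite abse_cabs poweR_EFin powR_mulrn ?normc_ge0// normcE2 !expr2.
Qed.

End L2.


Section L2_more.
Context d (T : measurableType d) (R : realType) (mu : {measure set T -> \bar R}).
Implicit Types (f g h : T -> R[i]).

Lemma rin_linl (c : R[i]) f g h : cL2 mu f -> cL2 mu g -> cL2 mu h ->
  rin mu (fun x => c * f x + g x) h =
  complex.Re c * rin mu f h + complex.Im c * rin mu (fun x => 'i%C * f x) h + rin mu g h.
Proof.
move=> fL gL hL; have ifL := cL2Z 'i%C fL.
rewrite rinDl//; last exact: cL2Z.
rewrite -!rinZl//; congr (_ + _); rewrite -rinDl//; do ?exact: cL2Z.
congr (rin _ _ _); apply/funext => x; case: c => a b; case: (f x) => u v.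
by apply/eqP; rewrite eq_complex/=; apply/andP; split; apply/eqP; ring.
Qed.

Lemma rin_linr (c : R[i]) f g h : cL2 mu f -> cL2 mu g -> cL2 mu h ->
  rin mu h (fun x => c * f x + g x) =
  complex.Re c * rin mu h f + complex.Im c * rin mu h (fun x => 'i%C * f x) + rin mu h g.
Proof.
by move=> fL gL hL; rewrite rinC rin_linl// [rin _ f h]rinC [rin _ g h]rinC [rin _ _ h]rinC.
Qed.

Lemma rin_iC f g : cL2 mu f -> cL2 mu g ->
  rin mu (fun x => 'i%C * f x) g = - rin mu f (fun x => 'i%C * g x).
Proof.
move=> fL gL; have ifL := cL2Z 'i%C fL; have igL := cL2Z 'i%C gL.
rewrite -[LHS]rin_ii -[RHS]mulN1r -rinZl//; congr (rin _ _ _).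
apply/funext => x; case: (f x) => u v.
by apply/eqP; rewrite eq_complex/=; apply/andP; split; apply/eqP; ring.
Qed.

Lemma cL2_sum I (r : seq I) (F : I -> T -> R[i]) : (forall i, cL2 mu (F i)) ->
  cL2 mu (fun x => \sum_(i <- r) F i x).
Proof.
move=> FL; elim: r => [|i r IH].
  by under eq_fun do rewrite big_nil; exact: cL2_0.
by under eq_fun do rewrite big_cons; exact: cL2D.
Qed.

Lemma rin0l f : cL2 mu f -> rin mu (fun=> 0) f = 0.
Proof.
move=> fL; have := rinZl 0 (cL2_0 mu) fL; rewrite [RHS]mul0r => <-.
by congr (rin _ _ _); apply/funext => x; rewrite mulr0.
Qed.

Lemma rin_suml I (r : seq I) (F : I -> T -> R[i]) f : (forall i, cL2 mu (F i)) ->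
  cL2 mu f -> rin mu (fun x => \sum_(i <- r) F i x) f = \sum_(i <- r) rin mu (F i) f.
Proof.
move=> FL fL; elim: r => [|i r IH].
  by under eq_fun do rewrite big_nil; rewrite big_nil rin0l.
under eq_fun do rewrite big_cons.
by rewrite rinDl// ?IH ?big_cons//; exact: cL2_sum.
Qed.

End L2_more.

(** * Everywhere defined operators *)

Section total_operator.
Context d (T : measurableType d) (R : realType) (mu : {measure set T -> \bar R}).
Variables (A : operator R T).
Hypotheses (linA : linear_operator mu A) (domA : dom A = cL2 mu).
Implicit Types (f g h : T -> R[i]).

Lemma op_cL2 f : cL2 mu f -> cL2 mu (A f).
Proof. by move=> fL; have [_ + _ _ _] := linA; apply; rewrite domA. Qed.

Lemma op_ae f g : cL2 mu f -> cL2 mu g -> f = g %[ae mu] -> A f = A g %[ae mu].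
Proof. by move=> fL gL fg; have [_ _ + _ _] := linA => /(_ f g); rewrite domA => -[]. Qed.

Lemma op_lin (c : R[i]) f g : cL2 mu f -> cL2 mu g ->
  A (fun x => c * f x + g x) = (fun x => c * A f x + A g x) %[ae mu].
Proof. by move=> fL gL; have [_ _ _ _ +] := linA => /(_ c f g); rewrite domA => -[]. Qed.

Lemma op0 : A (fun=> 0) = (fun=> 0) %[ae mu].
Proof.
have := op_lin (-1) (cL2_0 mu) (cL2_0 mu).
have -> : (fun x : T => -1 * 0 + 0 : R[i]) = (fun=> 0).
  by apply/funext => x; rewrite mulr0 addr0.
by apply: filterS => x + _ => /(_ I) ->; rewrite mulN1r addNr.
Qed.

Lemma op_sub f g : cL2 mu f -> cL2 mu g ->
  A (fun x => f x - g x) = (fun x => A f x - A g x) %[ae mu].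
Proof.
move=> fL gL; have := op_lin (-1) gL fL.
have -> : (fun x => -1 * g x + f x) = (fun x => f x - g x).
  by apply/funext => x; rewrite mulN1r addrC.
by apply: filterS => x + _ => /(_ I) ->; rewrite mulN1r addrC.
Qed.

Lemma op_sum J (r : seq J) (c : J -> R[i]) (F : J -> T -> R[i]) :
  (forall i, cL2 mu (F i)) ->
  A (fun x => \sum_(i <- r) c i * F i x) =
    (fun x => \sum_(i <- r) c i * A (F i) x) %[ae mu].
Proof.
move=> FL; elim: r => [|i r IH].
  under [X in A X]eq_fun do rewrite big_nil.
  by apply: filterS op0 => x + _ => /(_ I) ->; rewrite big_nil.
under [X in A X]eq_fun do rewrite big_cons.
have rL : cL2 mu (fun x => \sum_(j <- r) c j * F j x).
  by apply: (@cL2_sum _ _ _ _ _ r (fun j x => c j * F j x)) => j; exact: cL2Z.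
apply: filterS2 IH (op_lin (c i) (FL i) rL) => x + + _ => /(_ I) IH /(_ I) ->.
by rewrite IH big_cons.
Qed.

End total_operator.

(** * Scalar spectral measures *)

Section spectral.
Import HBNNSimple.
Context d d' (T : measurableType d) (S : measurableType d') (R : realType)
  (mu : {measure set T -> \bar R}) (E : set S -> operator R T).
Hypothesis specE : spectral_decomposition mu E.
Implicit Types (f g h : T -> R[i]) (A B : set S).

Lemma spec_linear A : measurable A -> linear_operator mu (E A).
Proof. by move=> mA; have [/(_ A mA)[]] := specE. Qed.

Lemma spec_dom A : measurable A -> dom (E A) = cL2 mu.
Proof. by move=> mA; have [/(_ A mA)[]] := specE. Qed.

Lemma spec_cL2 A f : measurable A -> cL2 mu f -> cL2 mu (E A f).
Proof. by move=> mA; apply: op_cL2; [exact: spec_linear|exact: spec_dom]. Qed.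

(** [E A] is symmetric and idempotent, so the scalar spectral measure is the
    square of a norm; its positivity and its null sets are then visible. *)
Lemma spec_rin A f : measurable A -> cL2 mu f -> rin mu (E A f) f = l2 mu (E A f) ^+ 2.
Proof.
move=> mA fL; have [/(_ A mA)[_ _ idem sym]] := specE.
have EfL := spec_cL2 mA fL.
rewrite l2_sqr// -(ae_eq_rin _ _ _ (idem f fL))//; last exact: spec_cL2.
by rewrite /rin sym.
Qed.

(** The scalar measure of the spectral decomposition, cut off outside of the
    measurable sets because a measure must be nonnegative on every set. *)
Definition spec_measure f of spectral_decomposition mu E & cL2 mu f : set S -> \bar R :=
  fun A => if `[< measurable A >] then spectral_measure mu E f A else 0%E.

Section spec_measure_is_measure.
Variables (f : T -> R[i]) (fL : cL2 mu f).
Local Notation nu := (spec_measure specE fL).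

Lemma spec_measureE A : measurable A -> nu A = (l2 mu (E A f) ^+ 2)%:E.
Proof.
move=> mA; rewrite /spec_measure; case: asboolP => // _.
by rewrite /spectral_measure -spec_rin.
Qed.

Let nu0 : nu set0 = 0%E.
Proof.
rewrite spec_measureE//; have [_ /(_ f fL) E0 _ _ _] := specE.
rewrite (ae_eq_l2 _ _ E0); [|exact: spec_cL2|exact: cL2_0].
by rewrite /l2 cLnorm0//= expr0n.
Qed.

Let nu_ge0 A : (0 <= nu A)%E.
Proof.
rewrite /spec_measure; case: asboolP => // mA.
by rewrite /spectral_measure lee_fin -/(rin _ _ _) spec_rin// sqr_ge0.
Qed.

Let nu_sigma_additive : semi_sigma_additive nu.
Proof.
move=> F mF tF mUF; have [_ _ _ _ /(_ F f mF tF fL) cvg0] := specE.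
pose D n x := E (\bigcup_k F k) f x - \sum_(k < n) E (F k) f x.
have SL n : cL2 mu (fun x => \sum_(k < n) E (F k) f x).
  by apply: (@cL2_sum _ _ _ _ _ _ (fun k : 'I_n => E (F k) f)) => k; exact: spec_cL2.
have UL : cL2 mu (E (\bigcup_k F k) f) by exact: spec_cL2.
have DL n : cL2 mu (D n) by exact: cL2B.
have cvgD : l2 mu (D n) @[n --> \oo] --> (0 : R) by exact: fine_cvg cvg0.
rewrite spec_measureE// -spec_rin//.
have -> : (fun n => \sum_(0 <= i < n) nu (F i))%E =
    (fun n => (rin mu (E (\bigcup_k F k) f) f - rin mu (D n) f)%:E).
  apply/funext => n; rewrite big_mkord.
  under eq_bigr do rewrite spec_measureE// -spec_rin//.
  rewrite sumEFin -(rin_suml _ (fun k : 'I_n => spec_cL2 (mF k) fL) fL); congr EFin.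
  apply/eqP; rewrite eq_sym subr_eq -rinDl//.
  rewrite (_ : (fun x => _ + _) = E (\bigcup_k F k) f)//.
    by apply/funext => x; rewrite addrC subrK.
  exact: SL.
apply: cvg_EFin; first by apply: nearW.
rewrite -[X in _ --> X]subr0; apply: cvgB; first exact: cvg_cst.
apply/norm_cvg0P; apply: (@squeeze_cvgr _ _ _ _ (cst 0) (fun n => l2 mu (D n) * l2 mu f)).
- by apply: nearW => n; rewrite normr_ge0 rin_cauchy_schwarz.
- exact: cvg_cst.
- by rewrite -[X in _ --> X](mul0r (l2 mu f)); apply: cvgM => //; exact: cvg_cst.
Qed.

HB.instance Definition _ := isMeasure.Build _ _ _ nu nu0 nu_ge0 nu_sigma_additive.

Let nu_fin : fin_num_fun nu.
Proof. by move=> A mA; rewrite spec_measureE. Qed.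

HB.instance Definition _ := Measure_isFinite.Build _ _ _ nu nu_fin.

End spec_measure_is_measure.

(** Monotonicity of the scalar spectral measure between [A] and [setT]. *)
Lemma spec_contraction A f : measurable A -> cL2 mu f -> l2 mu (E A f) <= l2 mu f.
Proof.
move=> mA fL; rewrite -(@ler_pXn2r _ 2)// ?nnegrE ?l2_ge0//.
have [_ _ /(_ f fL) ET _ _] := specE.
rewrite -(ae_eq_l2 _ _ ET)//; last exact: spec_cL2.
rewrite -lee_fin -!(spec_measureE fL)//; by apply: le_measure; rewrite ?inE.
Qed.

(** Only values on measurable sets enter the integral. This transfers integrals
    against a set function, which need not be nonnegative on every set, to
    integrals against a measure. *)
Lemma eq_setfun_integral (m1 m2 : set S -> \bar R) (g : S -> \bar R) :
  (forall A, measurable A -> m1 A = m2 A) ->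
  (\int[m1]_x g x = \int[m2]_x g x)%E.
Proof.
move=> m12.
rewrite /integral; congr (ereal_sup _ - ereal_sup _)%E;
  apply/seteqP; split => _ /= [k kh <-]; exists k => //;
  apply: (congr1 (fun h : R -> \bar R => (\sum_(x \in [set: R]) h x)%E));
  apply/funext => r; rewrite m12//; exact: measurable_funPTI.
Qed.

Lemma spec_integralE f (fL : cL2 mu f) (g : S -> \bar R) :
  (\int[spectral_measure mu E f]_s g s = \int[spec_measure specE fL]_s g s)%E.
Proof.
by apply: eq_setfun_integral => A mA; rewrite /spec_measure; case: asboolP.
Qed.

End spectral.


(** * Bounded functions of an operator *)

Section bounded_calculus.
Context d d' (T : measurableType d) (S : measurableType d') (R : realType)
  (mu : {measure set T -> \bar R}) (E : set S -> operator R T).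
Hypothesis specE : spectral_decomposition mu E.
Implicit Types (f g h : T -> R[i]).

Lemma spec_bounded_dom (F : S -> R[i]) : cmeasurable F -> cbounded F ->
  [set f | cL2 mu f /\ (\int[spectral_measure mu E f]_s (cabs F s * cabs F s) < +oo)%E] =
  cL2 mu.
Proof.
move=> mF [M FM]; apply/seteqP; split => [f []//|f fL]; split => //.
rewrite (spec_integralE specE fL).
apply: (@le_lt_trans _ _ (\int[spec_measure specE fL]_s (cst (M ^+ 2)%:E s))%E).
  apply: ge0_le_integral => //=.
  - by move=> s _; rewrite mule_ge0 ?cabs_ge0.
  - by apply: emeasurable_funM; exact: measurable_cabs.
  - move=> s _; rewrite -EFinM lee_fin expr2; apply: ler_pM => //; exact: normc_ge0.
by rewrite integral_cst//= spec_measureE// ltry.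
Qed.

Variables (F : S -> R[i]) (A : operator R T).
Hypothesis intA : is_spectral_integral mu E F A.
Hypothesis mF : cmeasurable F.

Lemma spec_integral_dom : cbounded F -> dom A = cL2 mu.
Proof. by move=> bF; have [_ -> _] := intA; exact: spec_bounded_dom. Qed.

Variables (M : R) (N S0 : set S).
Hypotheses (M0 : 0 <= M) (mN : measurable N) (mS0 : measurable S0).
Hypothesis EN : forall f, cL2 mu f -> E N f = (fun=> 0) %[ae mu].
Hypothesis FM : forall s, ~ N s -> Normc.normc (F s) <= M.
Hypothesis FS0 : forall s, ~ S0 s -> F s = 0.

Lemma spec_integral_le (u : S -> R) f : measurable_fun setT u -> cL2 mu f ->
  (forall s, `|u s| <= Normc.normc (F s)) ->
  `|fine (\int[spectral_measure mu E f]_s (u s)%:E)| <= M * l2 mu (E S0 f) ^+ 2.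
Proof.
move=> mu_ fL uF; rewrite (spec_integralE specE fL).
set nu := spec_measure specE fL.
have nuN : nu N = 0%E.
  rewrite /nu spec_measureE// (ae_eq_l2 _ _ (EN fL)); [|exact: spec_cL2|exact: cL2_0].
  by rewrite /l2 cLnorm0//= expr0n.
suff H : (`| \int[nu]_s (u s)%:E | <= (M * l2 mu (E S0 f) ^+ 2)%:E)%E.
  by move: H; case: (\int[nu]_s _)%E => [r| |] //=; rewrite lee_fin.
apply: le_trans (le_abse_integral nu measurableT _) _; first exact/measurable_EFinP.
have nuS0 : (\int[nu]_x (\1_S0 x)%:E = (l2 mu (E S0 f) ^+ 2)%:E)%E.
  by rewrite integral_indic// setIT -(spec_measureE specE fL mS0).
rewrite EFinM -nuS0 -ge0_integralZl//; last exact/measurable_EFinP/measurable_indic.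
apply: ae_ge0_le_integral => //.
- by apply/measurableT_comp => //; exact/measurable_EFinP.
- by move=> s _; rewrite mule_ge0 ?lee_fin.
- by apply: measurable_funeM; exact/measurable_EFinP/measurable_indic.
exists N; split => // s /=; apply: contra_notP => Ns _.
rewrite -EFinM lee_fin indicE; have [_|] := boolP (s \in S0).
  by rewrite mulr1; apply: le_trans (uF s) (FM Ns).
rewrite notin_setE => /FS0 Fs; rewrite mulr0.
by apply: le_trans (uF s) _; rewrite Fs Normc.normc0.
Qed.

(** The quadratic form of [A] at [h] is at most [M] times the squared norm [q h]
    of [E S0 h]. Polarization bounds [Re <A f, g>] by [2 M (q f + q g)]. Taking
    [g = s A f] and [q (A f) <= |A f|^2] gives
    [s |A f|^2 <= 2 M (|E S0 f|^2 + s^2 |A f|^2)] for all [s > 0], and the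
    choice [s = 1 / (4 M)] yields the bound. *)
Lemma spec_integral_bound f : cbounded F -> cL2 mu f ->
  l2 mu (A f) <= 4 * M * l2 mu (E S0 f).
Proof.
move=> bF fL; have domA := spec_integral_dom bF.
have [linA _ quad] := intA.
pose q h := l2 mu (E S0 h) ^+ 2.
have quadR h : cL2 mu h -> `|rin mu (A h) h| <= M * q h.
  move=> hL; rewrite /rin quad ?domA//=.
  by apply: spec_integral_le => //; [case: mF|move=> s; exact: norm_Re_normc].
have quadI h : cL2 mu h -> `|rin mu (A h) (fun x => 'i%C * h x)| <= M * q h.
  move=> hL; rewrite -Im_inner quad ?domA//=.
  by apply: spec_integral_le => //; [case: mF|move=> s; exact: norm_Im_normc].
have linE := spec_linear specE mS0; have domE := spec_dom specE mS0.
have q_le c g h : cL2 mu g -> cL2 mu h -> Normc.normc c = 1 ->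
    q (fun x => c * g x + h x) <= 2 * (q g + q h).
  move=> gL hL c1; rewrite /q.
  have EgL := op_cL2 linE domE gL; have EhL := op_cL2 linE domE hL.
  rewrite (ae_eq_l2 _ _ (op_lin linE domE c gL hL)); last 2 first.
  - by apply: (op_cL2 linE domE); exact: cL2_lin.
  - exact: cL2_lin.
  have : l2 mu (fun x => c * E S0 g x + E S0 h x) <= l2 mu (E S0 g) + l2 mu (E S0 h).
    by apply: le_trans (l2D (cL2Z c EgL) EhL) _; rewrite l2Z// c1 mul1r.
  have := l2_ge0 mu (fun x => c * E S0 g x + E S0 h x).
  move: (l2 _ _) (l2 mu (E S0 g)) (l2 mu (E S0 h)) => a b e a0 abe.
  by have := sqr_ge0 (b - e); nra.
(* [4 Re <A f, g>] combines the values of the quadratic form at [f + c g] for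
   the fourth roots of unity [c]: real parts for [c = 1, -1], imaginary parts
   for [c = i, -i]. *)
have polar g : cL2 mu g -> rin mu (A f) g <= 2 * M * (q f + q g).
  move=> gL; have igL := cL2Z 'i%C gL; have ifL := cL2Z 'i%C fL.
  have AfL := op_cL2 linA domA fL; have AgL := op_cL2 linA domA gL.
  have iAfL := cL2Z 'i%C AfL; have iAgL := cL2Z 'i%C AgL.
  pose h (c : R[i]) := fun x => c * g x + f x.
  have hL c : cL2 mu (h c) by exact: cL2_lin.
  have ihE c : (fun x => 'i%C * h c x) = (fun x => c * ('i%C * g x) + 'i%C * f x).
    by apply/funext => x; rewrite /h mulrDr mulrCA.
  have iig : (fun x => 'i%C * ('i%C * g x)) = (fun x => Complex (-1) 0 * g x).
    apply/funext => x; case: (g x) => a b.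
    by apply/eqP; rewrite eq_complex/=; apply/andP; split; apply/eqP; ring.
  have AhE c : A (h c) = (fun x => c * A g x + A f x) %[ae mu] by exact: op_lin.
  have AhL c : cL2 mu (A (h c)) by exact: op_cL2.
  have bndR c : Normc.normc c = 1 -> `|rin mu (A (h c)) (h c)| <= M * (2 * (q g + q f)).
    by move=> c1; apply: le_trans (quadR _ (hL c)) _; rewrite ler_wpM2l// q_le.
  have bndI c : Normc.normc c = 1 ->
      `|rin mu (A (h c)) (fun x => 'i%C * h c x)| <= M * (2 * (q g + q f)).
    by move=> c1; apply: le_trans (quadI _ (hL c)) _; rewrite ler_wpM2l// q_le.
  have c1 : Normc.normc (Complex 1 0 : R[i]) = 1 by rewrite normc_real normr1.
  have c2 : Normc.normc (Complex (-1) 0 : R[i]) = 1 by rewrite normc_real normrN1.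
  have c3 : Normc.normc (Complex 0 1 : R[i]) = 1 by rewrite /= expr0n expr1n add0r sqrtr1.
  have c4 : Normc.normc (Complex 0 (-1) : R[i]) = 1.
    by rewrite /= expr0n sqrrN expr1n add0r sqrtr1.
  have expandR c : rin mu (A (h c)) (h c) = rin mu (fun x => c * A g x + A f x) (h c).
    by apply: ae_eq_rin => //; exact: cL2_lin.
  have expandI c : rin mu (A (h c)) (fun x => 'i%C * h c x) =
      rin mu (fun x => c * A g x + A f x) (fun x => c * ('i%C * g x) + 'i%C * f x).
    by rewrite -ihE; apply: ae_eq_rin => //; [exact: cL2_lin|exact: cL2Z].
  have := bndR _ c1; have := bndR _ c2; have := bndI _ c3; have := bndI _ c4.
  rewrite !expandR !expandI /h.
  rewrite !rin_linl//; do ?[exact: cL2_lin]; do ?[by rewrite -ihE; exact: cL2Z].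
  rewrite !rin_linr// !iig !rinZr// !rin_ii !rin_iC//=.
  rewrite ?rin_ii.
  move: (rin mu (A f) g) (rin mu (A g) f) (rin mu (A f) f) (rin mu (A g) g)
    (rin mu (A f) (fun x => 'i%C * g x)) (rin mu (A g) (fun x => 'i%C * f x))
    (rin mu (A f) (fun x => 'i%C * f x)) (rin mu (A g) (fun x => 'i%C * g x)).
  move=> t1 t2 t3 t4 t5 t6 t7 t8.
  rewrite !ler_norml => /andP[i4l i4u] /andP[i3l i3u] /andP[r2l r2u] /andP[r1l r1u].
  by nra.
have AfL := op_cL2 linA domA fL.
set Y := l2 mu (A f); set e := l2 mu (E S0 f); set K := 2 * M.
have K0 : 0 <= K by rewrite mulr_ge0.
have Y0 : 0 <= Y by exact: l2_ge0.
have e0 : 0 <= e by exact: l2_ge0.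
have main s : 0 < s -> s * Y ^+ 2 <= K * (e ^+ 2 + s ^+ 2 * Y ^+ 2).
  move=> s0; have sL := cL2Z (Complex s 0) AfL.
  have := polar _ sL; rewrite rinZr// -l2_sqr// -/Y => /le_trans; apply.
  rewrite ler_wpM2l// lerD2l /q -exprMn ler_pXn2r// ?nnegrE ?l2_ge0//;
    last exact: mulr_ge0 (ltW s0) Y0.
  apply: le_trans (spec_contraction specE mS0 sL) _.
  by rewrite l2Z// normc_real gtr0_norm.
suff : Y ^+ 2 <= (4 * M * e) ^+ 2.
  by rewrite ler_pXn2r// nnegrE !mulr_ge0.
have [K00|Kn0] := eqVneq K 0.
  have := main _ ltr01; rewrite K00 mul0r mul1r => /le_trans; apply; exact: sqr_ge0.
have Kp : 0 < K by rewrite lt0r Kn0.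
have s0 : 0 < (2 * K)^-1 by rewrite invr_gt0; apply: mulr_gt0.
have K4 : 0 < 4 * K by apply: mulr_gt0.
have := main _ s0; rewrite -(ler_pM2l K4).
have -> : 4 * K * ((2 * K)^-1 * Y ^+ 2) = 2 * Y ^+ 2 by field.
have -> : 4 * K * (K * (e ^+ 2 + (2 * K)^-1 ^+ 2 * Y ^+ 2)) = (2 * K * e) ^+ 2 + Y ^+ 2.
  by field.
by rewrite /K; nra.
Qed.

End bounded_calculus.


(** * Closed subspaces and density *)

Section L2_induction.
Import HBSimple HBNNSimple.

Context d (T : measurableType d) (R : realType) (mu : {measure set T -> \bar R}).
Implicit Types (f g h : T -> R[i]) (A B : set T).

Definition cind A : T -> R[i] := fun x => Complex (\1_A x) 0.

Lemma cmeasurable_real (u : T -> R) : measurable_fun [set: T] u ->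
  cmeasurable (fun x => Complex (u x) 0).
Proof. by split => //=; exact: measurable_cst. Qed.

Lemma cmeasurable_cind A : measurable A -> cmeasurable (cind A).
Proof. by move=> mA; apply: cmeasurable_real; exact: measurable_indic. Qed.

Lemma cLnorm2_cind A : measurable A -> (cLnorm mu 2%:E (cind A) `^ 2 = mu A)%E.
Proof.
move=> mA; rewrite poweR_Lnorm// -[A in RHS]setIT -integral_indic//.
apply: eq_integral => x _; rewrite abse_cabs /cabs normc_real indicE.
by case: (x \in A); rewrite ?normr1 ?normr0 ?poweR1r ?poweR0r.
Qed.

Lemma cL2_cind A : measurable A -> (mu A < +oo)%E -> cL2 mu (cind A).
Proof.
move=> mA Aoo; split; first exact: cmeasurable_cind.
by apply: (@lty_poweRy _ _ 2) => //; rewrite cLnorm2_cind.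
Qed.

(** The closure condition only speaks of functions of [L^2] because [l2] is not
    a norm elsewhere. *)
Definition closed_subspace (V : set (T -> R[i])) :=
  [/\ V (fun=> 0), (forall (c : R[i]) f g, V f -> V g -> V (fun x => c * f x + g x)) &
  forall f, cL2 mu f -> (forall e : R, 0 < e ->
    exists g, [/\ V g, cL2 mu g & l2 mu (fun x => f x - g x) < e]) -> V f].

(** Dominated convergence for the squares: [|f - f_ n|^2 <= |f|^2]. *)
Lemma dominated_cvg_L2 f (f_ : nat -> T -> R[i]) (e : R) : cL2 mu f ->
  (forall n, cmeasurable (f_ n)) ->
  (forall x, Normc.normc (f x - f_ n x) @[n --> \oo] --> (0 : R)) ->
  (forall n x, Normc.normc (f x - f_ n x) <= Normc.normc (f x)) ->
  0 < e -> exists n, l2 mu (fun x => f x - f_ n x) < e.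
Proof.
move=> fL mf_ cvgf domf e0; have [mf _] := fL.
have DL n : cL2 mu (fun x => f x - f_ n x).
  apply: (cL2_le _ fL) => //.
  have -> : (fun x => f x - f_ n x) = (fun x => -1 * f_ n x + f x).
    by apply/funext => x; rewrite mulN1r addrC.
  exact: cmeasurable_lin.
have sqE g : cL2 mu g -> ((l2 mu g ^+ 2)%:E = \int[mu]_x (Normc.normc (g x) ^+ 2)%:E)%E.
  move=> gL; rewrite -powR_mulrn ?l2_ge0// -poweR_EFin -cL2E// poweR_Lnorm//.
  by apply: eq_integral => x _; rewrite abse_cabs poweR_EFin powR_mulrn// normc_ge0.
have msq g : cmeasurable g -> measurable_fun [set: T] (fun x => (Normc.normc (g x) ^+ 2)%:E).
  by move=> mg; apply/measurable_EFinP/measurable_funX; exact: measurable_normc.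
have := @dominated_cvg _ _ _ mu setT measurableT
  (fun n x => (Normc.normc (f x - f_ n x) ^+ 2)%:E) (cst 0%E)
  (fun x => (Normc.normc (f x) ^+ 2)%:E).
have H1 n : measurable_fun [set: T] (fun x => (Normc.normc (f x - f_ n x) ^+ 2)%:E).
  by apply: msq; have [] := DL n.
move=> /(_ H1) {H1}.
have H2 : forall x, [set: T] x ->
    (Normc.normc (f x - f_ n x) ^+ 2)%:E @[n --> \oo] --> cst 0%E x.
  move=> x _; apply: cvg_EFin; first exact: nearW.
  rewrite [X in _ --> X](_ : _ = 0 * 0 :> R); last by rewrite /= mul0r.
  under [X in X @ _ --> _]eq_fun do rewrite /= expr2.
  exact: cvgM (cvgf x) (cvgf x).
move=> /(_ H2) {H2} /(_ (fun x _ => erefl)).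
have H3 : mu.-integrable setT (fun x => (Normc.normc (f x) ^+ 2)%:E).
  apply/integrableP; split; first exact: msq.
  under eq_integral do rewrite gee0_abs ?lee_fin ?sqr_ge0//.
  by rewrite -sqE// ltry.
move=> /(_ H3) {H3}.
have H4 : forall n x, [set: T] x ->
    (`|(Normc.normc (f x - f_ n x) ^+ 2)%:E| <= (Normc.normc (f x) ^+ 2)%:E)%E.
  move=> n x _; rewrite gee0_abs ?lee_fin ?sqr_ge0// ler_pXn2r ?nnegrE ?normc_ge0//.
move=> /(_ H4) {H4}; rewrite integral0.
under eq_fun do rewrite -sqE//.
move=> /fine_cvg /cvgr0_norm_lt /(_ (e ^+ 2)); rewrite exprn_gt0// => /(_ isT).
move=> [n _ /(_ n (leqnn n))] /=; rewrite ger0_norm ?sqr_ge0// => H; exists n.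
by rewrite -(@ltr_pXn2r _ 2)// nnegrE ?l2_ge0// ltW.
Qed.

Variable V : set (T -> R[i]).
Hypothesis cV : closed_subspace V.

Lemma closedZ (c : R[i]) f : V f -> V (fun x => c * f x).
Proof.
by move=> Vf; have [V0 + _] := cV => /(_ c f _ Vf V0); under eq_fun do rewrite addr0.
Qed.

Lemma closedD f g : V f -> V g -> V (fun x => f x + g x).
Proof.
by move=> Vf Vg; have [_ + _] := cV => /(_ 1 f g Vf Vg); under eq_fun do rewrite mul1r.
Qed.

Lemma closedB f g : V f -> V g -> V (fun x => f x - g x).
Proof.
move=> Vf Vg; have [_ + _] := cV => /(_ (-1) g f Vg Vf).
by under eq_fun do rewrite mulN1r addrC.
Qed.

Lemma closed_sum I (r : seq I) (F : I -> T -> R[i]) : (forall i, V (F i)) ->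
  V (fun x => \sum_(i <- r) F i x).
Proof.
move=> VF; elim: r => [|i r IH].
  by under eq_fun do rewrite big_nil; have [] := cV.
by under eq_fun do rewrite big_cons; exact: closedD.
Qed.

Lemma closed_dominated f (f_ : nat -> T -> R[i]) : cL2 mu f ->
  (forall n, V (f_ n)) -> (forall n, cL2 mu (f_ n)) ->
  (forall x, Normc.normc (f x - f_ n x) @[n --> \oo] --> (0 : R)) ->
  (forall n x, Normc.normc (f x - f_ n x) <= Normc.normc (f x)) -> V f.
Proof.
move=> fL Vf fnL cvgf domf; have [_ _ +] := cV; apply => // e e0.
have [n fn] := dominated_cvg_L2 fL (fun n => (fnL n).1) cvgf domf e0.
by exists (f_ n).
Qed.

Hypothesis Vind : forall A, measurable A -> cL2 mu (cind A) -> V (cind A).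

(** A level set of a nonzero value has finite measure, since [g] is square
    integrable; the level set of [0] may not, but it contributes nothing. *)
Lemma closed_nnsfun (g : {nnsfun T >-> R}) : cL2 mu (fun x => Complex (g x) 0) ->
  V (fun x => Complex (g x) 0).
Proof.
move=> gL.
have -> : (fun x : T => Complex (g x) 0) = fun x : T =>
    \sum_(r <- finmap.enum_fset (fset_set (range g))) Complex r 0 * cind (g @^-1` [set r]) x.
  apply/funext => x; rewrite fimfunE fsbig_finite//=.
  rewrite (@big_morph _ _ (fun r : R => Complex r 0 : R[i]) 0 +%R 0 +%R)//; last first.
    by move=> a b; apply/eqP; rewrite eq_complex/= addr0 !eqxx.
  apply: eq_bigr => r _; apply/eqP; rewrite eq_complex/=.
  by rewrite !mulr0 !mul0r subr0 addr0 !eqxx.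
apply: (@closed_sum _ _ (fun r x => Complex r 0 * cind (g @^-1` [set r]) x)) => r.
have [->|r0] := eqVneq r 0.
  have -> : (fun x => Complex 0 0 * cind (g @^-1` [set 0]) x) = (fun=> 0).
    by apply/funext => x; rewrite mul0r.
  by have [] := cV.
apply: closedZ; have mA : measurable (g @^-1` [set r]) by exact: measurable_funPTI.
apply: Vind => //; apply: (cL2_le (cmeasurable_cind mA) (cL2Z (Complex r^-1 0) gL)) => x.
rewrite Normc.normcM !normc_real indicE; have [|_] := boolP (x \in _).
  by rewrite inE/= => ->; rewrite -normrM mulVf.
by rewrite normr0 mulr_ge0.
Qed.

Lemma closed_nneg (u : T -> R) : measurable_fun [set: T] u -> (forall x, 0 <= u x) ->
  cL2 mu (fun x => Complex (u x) 0) -> V (fun x => Complex (u x) 0).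
Proof.
move=> mu_ u0 uL.
have mu' : measurable_fun [set: T] (EFin \o u) by exact/measurable_EFinP.
pose g := nnsfun_approx measurableT mu'.
have gcvg x : g n x @[n --> \oo] --> u x.
  have u0' y : [set: T] y -> (0 <= (EFin \o u) y)%E by rewrite lee_fin.
  exact: (@fine_cvg _ _ _ _ _ (u x) (cvg_nnsfun_approx measurableT mu' u0' (x := x) I)).
have gle n x : g n x <= u x.
  rewrite -(cvg_lim _ (gcvg x))//; apply: nondecreasing_cvgn_le.
    by move=> i j ij; have /lefP/(_ x) := nd_nnsfun_approx measurableT mu' ij.
  by apply/cvg_ex; exists (u x).
have gL n : cL2 mu (fun x => Complex (g n x) 0).
  apply: (cL2_le _ uL) => [|x]; first exact: cmeasurable_real.
  by rewrite !normc_real !ger0_norm.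
have dE n x : Complex (u x) 0 - Complex (g n x) 0 = Complex (u x - g n x) 0 :> R[i].
  by apply/eqP; rewrite eq_complex/= subr0 !eqxx.
apply: (closed_dominated uL (fun n => closed_nnsfun (gL n)) gL) => [x|n x].
  under eq_fun do rewrite dE normc_real.
  apply/norm_cvg0P; rewrite -(subrr (u x)).
  by apply: cvgB; [exact: cvg_cst|exact: gcvg].
by rewrite dE !normc_real !ger0_norm ?subr_ge0// gerBl.
Qed.

(** Density of simple functions in the form of an induction principle: a
    nonnegative function is the dominated limit of simple functions, and a
    complex function is a combination of four nonnegative ones. *)
Lemma closed_subspace_full f : cL2 mu f -> V f.
Proof.
move=> fL; have [[mr mi] _] := fL.
have part (u : T -> R) : measurable_fun [set: T] u ->
    (forall x, `|u x| <= Normc.normc (f x)) -> V (fun x => Complex (u x) 0).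
  move=> mu_ uf.
  have pos (v : T -> R) : measurable_fun [set: T] v -> (forall x, 0 <= v x) ->
      (forall x, v x <= `|u x|) -> V (fun x => Complex (v x) 0).
    move=> mv v0 vu; apply: closed_nneg => //.
    apply: (cL2_le _ fL) => [|x]; first exact: cmeasurable_real.
    by rewrite normc_real ger0_norm// (le_trans (vu x)).
  have -> : (fun x => Complex (u x) 0) =
      (fun x => Complex (Num.max (u x) 0) 0 - Complex (Num.max (- u x) 0) 0).
    apply/funext => x; apply/eqP; rewrite eq_complex/= subr0 eqxx andbT.
    have [u0|u0] := leP 0 (u x).
      by rewrite max_r ?subr0 ?eqxx// oppr_le0.
    by rewrite max_l ?sub0r ?opprK ?eqxx// oppr_ge0 ltW.
  apply: closedB; apply: pos.
  - by apply: measurable_maxr => //; exact: measurable_cst.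
  - by move=> x; rewrite le_max lexx orbT.
  - by move=> x; rewrite ge_max ler_norm normr_ge0.
  - by apply: measurable_maxr; [exact: measurable_funN|exact: measurable_cst].
  - by move=> x; rewrite le_max lexx orbT.
  - by move=> x; rewrite ge_max -normrN ler_norm normr_ge0.
have -> : f = (fun x => 'i%C * Complex (complex.Im (f x)) 0 + Complex (complex.Re (f x)) 0).
  apply/funext => x; case: (f x) => a b; apply/eqP; rewrite eq_complex/=.
  by apply/andP; split; apply/eqP; ring.
have [_ + _] := cV; apply; apply: part => // x.
  exact: norm_Im_normc.
exact: norm_Re_normc.
Qed.

End L2_induction.


(** * Density of finite sums of tensors *)

Section tensor_density.
Context d1 d2 (T1 : measurableType d1) (T2 : measurableType d2) (R : realType).
Variables (mu1 : {sigma_finite_measure set T1 -> \bar R})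
  (mu2 : {sigma_finite_measure set T2 -> \bar R}).
Local Notation mu := (mu1 \x mu2)%E.

Lemma cmeasurable_tensor (f1 : T1 -> R[i]) (f2 : T2 -> R[i]) :
  cmeasurable f1 -> cmeasurable f2 ->
  cmeasurable (fun z : T1 * T2 => f1 z.1 * f2 z.2).
Proof.
move=> mf1 mf2; apply: cmeasurableM.
  exact: cmeasurable_comp mf1 measurable_fst.
exact: cmeasurable_comp mf2 measurable_snd.
Qed.

Lemma cLnorm_tensor (f1 : T1 -> R[i]) (f2 : T2 -> R[i]) :
  cL2 mu1 f1 -> cL2 mu2 f2 ->
  cLnorm mu 2%:E (fun z => f1 z.1 * f2 z.2) = (l2 mu1 f1 * l2 mu2 f2)%:E.
Proof.
move=> f1L f2L; have [mf1 _] := f1L; have [mf2 _] := f2L.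
rewrite /cLnorm Lnorm2_prod1; last by apply: measurable_cabs; exact: cmeasurable_tensor.
rewrite (_ : (fun x => _) = fun x => (l2 mu2 f2)%:E * cabs f1 x)%E; last first.
  apply/funext => x; rewrite -cL2E// [RHS]muleC -cLnormZ//.
rewrite LnormZl ?l2_ge0//; last exact: measurable_cabs.
by rewrite -/(cLnorm _ _ _) cL2E// EFinM muleC.
Qed.

Lemma cL2_tensor (f1 : T1 -> R[i]) (f2 : T2 -> R[i]) : cL2 mu1 f1 -> cL2 mu2 f2 ->
  cL2 mu (fun z => f1 z.1 * f2 z.2).
Proof.
move=> f1L f2L; split; last by rewrite cLnorm_tensor// ltry.
by apply: cmeasurable_tensor; [case: f1L|case: f2L].
Qed.

Lemma l2_tensor (f1 : T1 -> R[i]) (f2 : T2 -> R[i]) : cL2 mu1 f1 -> cL2 mu2 f2 ->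
  l2 mu (fun z => f1 z.1 * f2 z.2) = l2 mu1 f1 * l2 mu2 f2.
Proof. by move=> f1L f2L; rewrite /l2 cLnorm_tensor. Qed.

Section induction.
Variable V : set (T1 * T2 -> R[i]).
Hypothesis cV : closed_subspace mu V.
Hypothesis VT : forall f1 f2, cL2 mu1 f1 -> cL2 mu2 f2 -> V (fun z => f1 z.1 * f2 z.2).

Let cind_rect (A1 : set T1) (A2 : set T2) :
  cind R (A1 `*` A2) = fun z => cind R A1 z.1 * cind R A2 z.2.
Proof.
apply/funext => -[x y]; apply/eqP; rewrite eq_complex/= !indicE.
rewrite mulr0 mul0r subr0 mulr0 addr0 eqxx andbT -natrM mulnb; apply/eqP; congr (_%:R).
by congr nat_of_bool; rewrite in_setX.
Qed.

(** Density of elementary tensors in the form of an induction principle. It is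
    enough to reach indicators. In a rectangle of finite measure, the sets with
    indicator in [V] form a lambda-system that contains the rectangles, which
    generate the product sigma-algebra; an arbitrary set is exhausted by its
    intersections with such rectangles. *)
Lemma tensor_induction f : cL2 mu f -> V f.
Proof.
have /sigma_finiteP[F1 [F1T F1nd F1oo]] := sigma_finiteT mu1.
have /sigma_finiteP[F2 [F2T F2nd F2oo]] := sigma_finiteT mu2.
pose Q n := F1 n `*` F2 n.
have mQ n : measurable (Q n) by apply: measurableX; [case: (F1oo n)|case: (F2oo n)].
have Qnd m n : (m <= n)%N -> Q m `<=` Q n.
  by move=> mn; apply: setSX; apply/subsetPset; do ?[exact: F1nd|exact: F2nd].
have Qoo n : (mu (Q n) < +oo)%E.
  have [m1 o1] := F1oo n; have [m2 o2] := F2oo n.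
  by rewrite product_measure1E// lte_mul_pinfty// ge0_fin_numE.
have QT z : exists n, Q n z.
  have : setT z.1 by []. rewrite F1T => -[n1 _ h1].
  have : setT z.2 by []. rewrite F2T => -[n2 _ h2].
  exists (maxn n1 n2); split.
    by move: h1; apply/subsetPset; apply: F1nd; exact: leq_maxl.
  by move: h2; apply/subsetPset; apply: F2nd; exact: leq_maxr.
have QL n A : measurable A -> cL2 mu (cind R (A `&` Q n)).
  move=> mA; apply: cL2_cind; first exact: measurableI.
  by apply: le_lt_trans (Qoo n); apply: le_measure; rewrite ?inE//; exact: measurableI.
have cind_cvg (A : set (T1 * T2)) (B : nat -> set (T1 * T2)) z :
    (forall m n, (m <= n)%N -> B m `<=` B n) -> (forall n, B n `<=` A) ->
    (A z -> exists n, B n z) ->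
    Normc.normc (cind R A z - cind R (B n) z) @[n --> \oo] --> (0 : R).
  move=> Bnd BA AB; apply: cvg_near_cst.
  have [Az|nAz] := pselect (A z).
    have [n Bn] := AB Az; exists n => // m nm.
    have Bm := Bnd _ _ nm _ Bn.
    by rewrite /cind !indicE !mem_set// subrr Normc.normc0.
  apply: nearW => n; rewrite /cind !indicE !memNset ?subrr ?Normc.normc0//.
  by move/BA.
have cind_le (A B : set (T1 * T2)) z : B `<=` A ->
    Normc.normc (cind R A z - cind R B z) <= Normc.normc (cind R A z).
  move=> BA; rewrite /cind !indicE; have [zB|_] := boolP (z \in B).
    by rewrite (mem_set (BA _ (set_mem zB))) subrr Normc.normc0 normc_ge0.
  by rewrite (_ : Complex _ _ - Complex 0 0 = Complex (z \in A)%:R 0)// subr0.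
have VQ n A : measurable A -> V (cind R (A `&` Q n)).
  pose C := [set A1 `*` A2 | A1 in @measurable _ T1 & A2 in @measurable _ T2].
  pose H := [set A : set (T1 * T2) | measurable A /\ V (cind R (A `&` Q n))].
  suff : <<s C >> `<=` H.
    by move=> CH mA; have [] := CH A; rewrite // -measurable_prod_measurableType.
  apply: lambda_system_subset => //.
  - move=> _ _ [A1 mA1 [A2 mA2 <-]] [B1 mB1 [B2 mB2 <-]].
    exists (A1 `&` B1); first exact: measurableI.
    by exists (A2 `&` B2); [exact: measurableI|rewrite setXI].
  - split => //.
    + split => //; rewrite setTI cind_rect; have [m1 o1] := F1oo n; have [m2 o2] := F2oo n.
      by apply: VT; exact: cL2_cind.
    + move=> A' B BA [mA' VA] [mB VB]; split; first exact: measurableD.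
      rewrite (_ : cind R _ = fun z => cind R (A' `&` Q n) z - cind R (B `&` Q n) z).
        exact: (closedB cV VA VB).
      apply/funext => z; apply/eqP; rewrite eq_complex/= subr0 eqxx andbT !indicE.
      rewrite [X in (nat_of_bool X)%:R == _]classical_sets.in_setI.
      rewrite classical_sets.in_setD !classical_sets.in_setI.
      have : z \in B -> z \in A' by rewrite !inE; exact: BA.
      case: (z \in B); case: (z \in A'); case: (z \in Q n); rewrite /= ?subrr ?subr0 ?eqxx//;
        by move=> /(_ isT).
    + move=> B Bnd HB; have mB : measurable (\bigcup_i B i).
        by apply: bigcupT_measurable => i; case: (HB i).
      split => //; apply: (closed_dominated cV (f_ := fun i => cind R (B i `&` Q n))).
      * exact: QL.
      * by move=> i; case: (HB i).
      * by move=> i; apply: QL; case: (HB i).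
      * move=> z; apply: cind_cvg => [i j ij|i|[[i _ Bi] Qz]].
        - by apply: setSI; apply/subsetPset; exact: Bnd.
        - by apply: setSI; exact: bigcup_sup.
        - by exists i.
      * by move=> i z; apply: cind_le; apply: setSI; exact: bigcup_sup.
  - move=> _ [A1 mA1 [A2 mA2 <-]]; split; first exact: measurableX.
    have [m1 o1] := F1oo n; have [m2 o2] := F2oo n.
    rewrite -setXI cind_rect; apply: VT; apply: cL2_cind; do ?exact: measurableI.
      by apply: le_lt_trans o1; apply: le_measure; rewrite ?inE//; exact: measurableI.
    by apply: le_lt_trans o2; apply: le_measure; rewrite ?inE//; exact: measurableI.
apply: closed_subspace_full => // A mA AL.
apply: (closed_dominated cV (f_ := fun i => cind R (A `&` Q i))) => //.
- by move=> n; exact: VQ.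
- by move=> n; exact: QL.
- move=> z; apply: cind_cvg => [i j ij|i|Az].
  + by apply: setIS; exact: Qnd.
  + exact: subIsetl.
  + by have [n Qn] := QT z; exists n.
- by move=> n z; apply: cind_le; exact: subIsetl.
Qed.

End induction.

Definition tensor_sum (I : finType) (a : I -> T1 -> R[i]) (b : I -> T2 -> R[i])
  (z : T1 * T2) : R[i] := \sum_i a i z.1 * b i z.2.

Lemma cL2_tensor_sum (I : finType) (a : I -> T1 -> R[i]) (b : I -> T2 -> R[i]) :
  (forall i, cL2 mu1 (a i)) -> (forall i, cL2 mu2 (b i)) -> cL2 mu (tensor_sum a b).
Proof.
by move=> aL bL; apply: (@cL2_sum _ _ _ _ _ _ (fun i z => a i z.1 * b i z.2)) => i;
  exact: cL2_tensor.
Qed.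

(** The functions that can be approximated form a closed subspace with all
    elementary tensors. *)
Lemma tensor_sum_dense f (e : R) : cL2 mu f -> 0 < e ->
  exists (I : finType) (a : I -> T1 -> R[i]) (b : I -> T2 -> R[i]),
    [/\ forall i, cL2 mu1 (a i), forall i, cL2 mu2 (b i) &
        l2 mu (fun z => f z - tensor_sum a b z) < e].
Proof.
move=> fL e0.
pose V := [set f | cL2 mu f /\ forall e : R, 0 < e ->
  exists (I : finType) (a : I -> T1 -> R[i]) (b : I -> T2 -> R[i]),
    [/\ forall i, cL2 mu1 (a i), forall i, cL2 mu2 (b i) &
        l2 mu (fun z => f z - tensor_sum a b z) < e]].
suff : V f by move=> [_ /(_ e e0)].
have l2_self g : l2 mu (fun z => g z - g z) = 0.
  by under eq_fun do rewrite subrr; rewrite /l2 cLnorm0.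
apply: tensor_induction fL => [|f1 f2 f1L f2L]; last first.
  split; [exact: cL2_tensor|move=> r r0].
  exists unit, (fun=> f1), (fun=> f2); split => //.
  rewrite [X in l2 _ X](_ : _ = fun z => f1 z.1 * f2 z.2 - f1 z.1 * f2 z.2).
    by rewrite (l2_self (fun z => f1 z.1 * f2 z.2)).
  by apply/funext => z; rewrite /tensor_sum big_const card_unit/= addr0.
split.
- split; [exact: cL2_0|move=> r r0].
  exists unit, (fun _ _ => 0), (fun _ _ => 0); split; [|move=> _; exact: cL2_0..|].
    by move=> _; exact: cL2_0.
  rewrite [X in l2 _ X](_ : _ = fun z => 0 - 0); first by rewrite (l2_self (fun=> 0)).
  by apply/funext => z; rewrite /tensor_sum big1// => i _; rewrite mulr0.
- move=> c g h [gL gV] [hL hV]; split; [exact: cL2_lin|move=> r r0].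
  (* the shift by [1] avoids a division by [0] when [c = 0] *)
  have k0 : 0 < Normc.normc c + 1 by rewrite ltr_wpDl// normc_ge0.
  have r2 : 0 < r / 2 by rewrite divr_gt0.
  have [I [a [b [aL bL lt1]]]] := gV (r / 2 / (Normc.normc c + 1)) (divr_gt0 r2 k0).
  have [J [a' [b' [aL' bL' lt2]]]] := hV (r / 2) r2.
  exists (I + J)%type,
    (fun i => match i with inl i => fun x => c * a i x | inr j => a' j end),
    (fun i => match i with inl i => b i | inr j => b' j end).
  split => [[i|j]|[i|j]|] //; first exact: cL2Z.
  have abL := cL2_tensor_sum aL bL; have abL' := cL2_tensor_sum aL' bL'.
  rewrite [X in l2 _ X](_ : _ = fun z => c * (g z - tensor_sum a b z) + (h z - tensor_sum a' b' z)).
    apply: le_lt_trans (l2D (cL2Z c (cL2B gL abL)) (cL2B hL abL')) _.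
    rewrite l2Z; last exact: cL2B.
    rewrite [r in ltRHS]splitr; apply: ler_ltD => //.
    apply: (@le_trans _ _ ((Normc.normc c + 1) * (r / 2 / (Normc.normc c + 1)))).
      by apply: ler_pM; rewrite ?normc_ge0 ?l2_ge0 ?lerDl// ltW.
    by rewrite mulrC divfK// gt_eqF.
  apply/funext => z; rewrite /tensor_sum big_sumType/=.
  have -> : \sum_i c * a i z.1 * b i z.2 = c * \sum_i a i z.1 * b i z.2.
    by rewrite mulr_sumr; apply: eq_bigr => i _; rewrite mulrA.
  by rewrite mulrBr opprD addrACA.
- move=> g gL gV; split => // r r0.
  have r2 : 0 < r / 2 by rewrite divr_gt0.
  have [h [[hL hV] _ lt1]] := gV (r / 2) r2.
  have [I [a [b [aL bL lt2]]]] := hV (r / 2) r2.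
  exists I, a, b; split => //; have abL := cL2_tensor_sum aL bL.
  rewrite [X in l2 _ X](_ : _ = fun z => (g z - h z) + (h z - tensor_sum a b z)).
    apply: le_lt_trans (l2D (cL2B gL hL) (cL2B hL abL)) _.
    by rewrite [r in ltRHS]splitr; exact: ltrD.
  by apply/funext => z; rewrite addrA subrK.
Qed.

End tensor_density.


(** * Tensor products of restricted bounds *)

Section tensor_bound.
Context d1 d2 (T1 : measurableType d1) (T2 : measurableType d2) (R : realType).
Variables (mu1 : {sigma_finite_measure set T1 -> \bar R})
  (mu2 : {sigma_finite_measure set T2 -> \bar R}).
Local Notation mu := (mu1 \x mu2)%E.

Lemma cmeasurable_slice1 (f : T1 * T2 -> R[i]) x : cmeasurable f ->
  cmeasurable (fun y => f (x, y)).
Proof. by move=> mf; apply: (cmeasurable_comp mf); exact: measurable_pair1. Qed.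

Lemma cmeasurable_slice2 (f : T1 * T2 -> R[i]) y : cmeasurable f ->
  cmeasurable (fun x => f (x, y)).
Proof. by move=> mf; apply: (cmeasurable_comp mf); exact: measurable_pair2. Qed.

Lemma measurable_cLnorm_slice1 (f : T1 * T2 -> R[i]) (p : R) : cmeasurable f ->
  measurable_fun [set: T1] (fun x => cLnorm mu2 p%:E (fun y => f (x, y))).
Proof. by move=> mf; apply: (measurable_Lnorm_slice1 mu2 p (measurable_cabs mf)). Qed.

Lemma measurable_cLnorm_slice2 (f : T1 * T2 -> R[i]) (p : R) : cmeasurable f ->
  measurable_fun [set: T2] (fun y => cLnorm mu1 p%:E (fun x => f (x, y))).
Proof. by move=> mf; apply: (measurable_Lnorm_slice2 mu1 p (measurable_cabs mf)). Qed.

Lemma mixed_norm12D (p q : R) (f g : T1 * T2 -> R[i]) : 1 <= p -> 1 <= q ->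
  cmeasurable f -> cmeasurable g ->
  (mixed_norm12 mu1 mu2 p q (fun z => (f z + g z)%R) <=
   mixed_norm12 mu1 mu2 p q f + mixed_norm12 mu1 mu2 p q g)%E.
Proof.
move=> p1 q1 mf mg.
have mfx := measurable_cLnorm_slice1 q mf; have mgx := measurable_cLnorm_slice1 q mg.
apply: le_trans (Lnorm_triangle mu1 p1 mfx mgx).
apply: le_Lnorm; first by rewrite (le_trans _ p1).
- exact: (measurable_cLnorm_slice1 q (cmeasurableD mf mg)).
- exact: emeasurable_funD.
move=> x; rewrite !gee0_abs ?adde_ge0 ?cLnorm_ge0//.
by exact: (cLnormD mu2 q1 (cmeasurable_slice1 x mf) (cmeasurable_slice1 x mg)).
Qed.

Variables (p1 p2 : R) (B1 : set T1) (B2 : set T2) (K1 K2 : R).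
Hypotheses (hp1 : 1 <= p1 <= 2) (hp2 : 1 <= p2 <= 2).
Hypotheses (mB1 : measurable B1) (mB2 : measurable B2) (K10 : 0 <= K1) (K20 : 0 <= K2).
Hypothesis dom1 : forall f : T1 -> \bar R, measurable_fun [set: T1] f ->
  (forall x, ~ B1 x -> f x = 0%E) -> ('N[mu1]_p1%:E[f] <= K1%:E * 'N[mu1]_2%:E[f])%E.
Hypothesis dom2 : forall f : T2 -> \bar R, measurable_fun [set: T2] f ->
  (forall x, ~ B2 x -> f x = 0%E) -> ('N[mu2]_p2%:E[f] <= K2%:E * 'N[mu2]_2%:E[f])%E.

Let p1_ge1 : 1 <= p1. Proof. by case/andP: hp1. Qed.
Let p2_ge1 : 1 <= p2. Proof. by case/andP: hp2. Qed.
Let p1_ge0 : 0 <= p1. Proof. by rewrite (le_trans _ p1_ge1). Qed.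
Let p2_ge0 : 0 <= p2. Proof. by rewrite (le_trans _ p2_ge1). Qed.
Let p1_neq0 : p1 != 0. Proof. by rewrite gt_eqF// (lt_le_trans _ p1_ge1). Qed.
Let p2_neq0 : p2 != 0. Proof. by rewrite gt_eqF// (lt_le_trans _ p2_ge1). Qed.

(** Domination in each variable in turn. It makes the mixed norm continuous for
    the [L^2] norm, so that a bound may be checked on a dense subset. *)
Lemma mixed_norm12_le_L2 (f : T1 * T2 -> R[i]) : cmeasurable f ->
  (forall z, ~ (B1 `*` B2) z -> f z = 0) ->
  (mixed_norm12 mu1 mu2 p1 p2 f <= (K1 * K2)%:E * cLnorm mu 2%:E f)%E.
Proof.
move=> mf fB.
rewrite /cLnorm Lnorm2_prod1; last exact: measurable_cabs.
have m2 := measurable_cLnorm_slice1 2 mf.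
apply: (@le_trans _ _ ('N[mu1]_p1%:E[(fun x => K2%:E * cLnorm mu2 2%:E (fun y => f (x, y)))%E])%E).
  apply: le_Lnorm => //; first exact: measurable_cLnorm_slice1.
    exact: measurable_funeM.
  move=> x; rewrite !gee0_abs ?mule_ge0 ?cLnorm_ge0 ?lee_fin//.
  apply: dom2; first by apply: measurable_cabs; exact: cmeasurable_slice1.
  by move=> y By; rewrite /cabs fB ?Normc.normc0// => -[].
rewrite LnormZl// mulrC EFinM -muleA lee_wpmul2l ?lee_fin//.
apply: dom1 => // x Bx; rewrite (_ : (fun y => f (x, y)) = fun=> 0) ?cLnorm0//.
by apply/funext => y; apply: fB => -[].
Qed.

Variables (A1 : operator R T1) (A2 : operator R T2) (A : operator R (T1 * T2)).
Hypotheses (lin1 : linear_operator mu1 A1) (domA1 : dom A1 = cL2 mu1).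
Hypotheses (lin2 : linear_operator mu2 A2) (domA2 : dom A2 = cL2 mu2).
Hypotheses (linA : linear_operator mu A) (domA : dom A = cL2 mu).
Hypothesis AT : forall f1 f2, cL2 mu1 f1 -> cL2 mu2 f2 ->
  A (fun z => f1 z.1 * f2 z.2) = (fun z => A1 f1 z.1 * A2 f2 z.2) %[ae mu].
Hypothesis contrA : forall f, cL2 mu f -> l2 mu (A f) <= l2 mu f.
Variables (c1 c2 : R).
Hypotheses (c10 : 0 <= c1) (c20 : 0 <= c2).
Hypothesis bnd1 : forall f, cL2 mu1 f -> (forall x, ~ B1 x -> f x = 0) ->
  (cLnorm mu1 2%:E (A1 f) <= c1%:E * cLnorm mu1 p1%:E f)%E.
Hypothesis bnd2 : forall f, cL2 mu2 f -> (forall x, ~ B2 x -> f x = 0) ->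
  (cLnorm mu2 2%:E (A2 f) <= c2%:E * cLnorm mu2 p2%:E f)%E.

Section on_tensor_sums.
Variables (I : finType) (a : I -> T1 -> R[i]) (b : I -> T2 -> R[i]).
Hypotheses (aL : forall i, cL2 mu1 (a i)) (bL : forall i, cL2 mu2 (b i)).
Hypotheses (aB : forall i x, ~ B1 x -> a i x = 0) (bB : forall i y, ~ B2 y -> b i y = 0).

Let A1aL i : cL2 mu1 (A1 (a i)). Proof. exact: op_cL2. Qed.
Let A2bL i : cL2 mu2 (A2 (b i)). Proof. exact: op_cL2. Qed.
Let h := tensor_sum a (fun i => A2 (b i)).
Let w := tensor_sum (fun i => A1 (a i)) (fun i => A2 (b i)).
Let hL : cL2 mu h. Proof. exact: cL2_tensor_sum. Qed.
Let wL : cL2 mu w. Proof. exact: cL2_tensor_sum. Qed.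

Lemma op_tensor_sum : A (tensor_sum a b) = w %[ae mu].
Proof.
have abL i : cL2 mu (fun z => a i z.1 * b i z.2) by exact: cL2_tensor.
have -> : tensor_sum a b = fun z => \sum_i 1 * (a i z.1 * b i z.2).
  by apply/funext => z; apply: eq_bigr => i _; rewrite mul1r.
have E1 := op_sum linA domA (index_enum I) (fun=> 1) abL.
apply: (ae_eq_trans E1).
have : \forall z \ae mu, forall i, A (fun z => a i z.1 * b i z.2) z = A1 (a i) z.1 * A2 (b i) z.2.
  by apply: filter_forall => i; apply: filterS (AT (aL i) (bL i)) => z; apply.
by apply: filterS => z Ez _; apply: eq_bigr => i _; rewrite mul1r Ez.
Qed.

(** At fixed [y], [w] and [h] are the same linear combination of the functions
    [A1 (a i)] and [a i], so linearity turns the slice of [w] into the image of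
    the slice of [h]. This avoids any question of joint measurability for an
    operator acting on the slices of a general function. *)
Lemma slice1_bound y :
  (cLnorm mu1 2%:E (fun x => w (x, y)) <= c1%:E * cLnorm mu1 p1%:E (fun x => h (x, y)))%E.
Proof.
have sL : cL2 mu1 (fun x => \sum_i A2 (b i) y * a i x).
  by apply: (@cL2_sum _ _ _ _ _ _ (fun i x => A2 (b i) y * a i x)) => i; exact: cL2Z.
have hE : (fun x => h (x, y)) = fun x => \sum_i A2 (b i) y * a i x.
  by apply/funext => x; apply: eq_bigr => i _; rewrite mulrC.
have wE : (fun x => w (x, y)) = fun x => \sum_i A2 (b i) y * A1 (a i) x.
  by apply/funext => x; apply: eq_bigr => i _; rewrite mulrC.
have -> : cLnorm mu1 2%:E (fun x => w (x, y)) =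
    cLnorm mu1 2%:E (A1 (fun x => \sum_i A2 (b i) y * a i x)).
  rewrite wE; apply/esym/ae_eq_cLnorm; last exact: op_sum.
    by have [] := op_cL2 lin1 domA1 sL.
  suff [] : cL2 mu1 (fun x => \sum_i A2 (b i) y * A1 (a i) x) by [].
  by apply: (@cL2_sum _ _ _ _ _ _ (fun i x => A2 (b i) y * A1 (a i) x)) => i; exact: cL2Z.
rewrite hE; apply: bnd1 => // x Bx.
by rewrite big1// => i _; rewrite aB// mulr0.
Qed.

Lemma slice2_bound x :
  (cLnorm mu2 2%:E (fun y => h (x, y)) <=
   c2%:E * cLnorm mu2 p2%:E (fun y => tensor_sum a b (x, y)))%E.
Proof.
have sL : cL2 mu2 (fun y => \sum_i a i x * b i y).
  by apply: (@cL2_sum _ _ _ _ _ _ (fun i y => a i x * b i y)) => i; exact: cL2Z.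
have -> : cLnorm mu2 2%:E (fun y => h (x, y)) =
    cLnorm mu2 2%:E (A2 (fun y => \sum_i a i x * b i y)).
  apply/esym/ae_eq_cLnorm; last exact: op_sum.
    by have [] := op_cL2 lin2 domA2 sL.
  by apply: cmeasurable_slice1; case: hL.
apply: bnd2 => // y By.
by rewrite big1// => i _; rewrite bB// mulr0.
Qed.

(** The slice bounds in the two variables, with Minkowski's inequality between
    them: the bound for [A1] leaves the exponent [2] in [y] outside, whereas the
    bound for [A2] needs it inside. *)
Lemma tensor_sum_bound :
  (cLnorm mu 2%:E (A (tensor_sum a b)) <=
   (c1 * c2)%:E * mixed_norm12 mu1 mu2 p1 p2 (tensor_sum a b))%E.
Proof.
have [mh _] := hL; have [mw _] := wL.
have abL : cL2 mu (tensor_sum a b) by exact: cL2_tensor_sum.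
have [mab _] := abL.
rewrite (ae_eq_cLnorm _ _ _ op_tensor_sum)//; last by have [] := op_cL2 linA domA abL.
rewrite /cLnorm Lnorm2_prod2; last exact: measurable_cabs.
have m1 := measurable_cLnorm_slice2 p1 mh.
have m2 := measurable_cLnorm_slice1 2 mh.
have m3 := measurable_cLnorm_slice1 p2 mab.
apply: (@le_trans _ _
    ('N[mu2]_2%:E[(fun y => c1%:E * cLnorm mu1 p1%:E (fun x => h (x, y)))%E])%E).
  apply: le_Lnorm => //; first exact: measurable_cLnorm_slice2.
    exact: measurable_funeM.
  move=> y; rewrite !gee0_abs ?mule_ge0 ?cLnorm_ge0 ?lee_fin//.
  exact: slice1_bound.
rewrite LnormZl// EFinM -muleA lee_wpmul2l ?lee_fin//.
apply: le_trans (Lnorm_swap hp1 (measurable_cabs mh) _) _.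
  apply: (@le_lt_trans _ _
      ('N[mu2]_2%:E[(fun y => K1%:E * cLnorm mu1 2%:E (fun x => h (x, y)))%E])%E).
    apply: le_Lnorm => //.
      by apply: measurable_funeM; exact: measurable_cLnorm_slice2.
    move=> y; rewrite !gee0_abs ?mule_ge0 ?cLnorm_ge0 ?lee_fin//.
    apply: dom1; first by apply: measurable_cabs; exact: cmeasurable_slice2.
    move=> x Bx; rewrite /cabs /h /tensor_sum big1 ?Normc.normc0// => i _ /=.
    by rewrite aB// mul0r.
  rewrite LnormZl//; last exact: measurable_cLnorm_slice2.
  rewrite -(@Lnorm2_prod2 _ _ _ _ _ mu1 mu2 (cabs h)); last exact: measurable_cabs.
  by rewrite lte_mul_pinfty ?lee_fin//; case: hL.
apply: (@le_trans _ _
    ('N[mu1]_p1%:E[(fun x => c2%:E * cLnorm mu2 p2%:E (fun y => tensor_sum a b (x, y)))%E])%E).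
  apply: le_Lnorm => //; first exact: measurable_funeM.
  move=> x; rewrite !gee0_abs ?mule_ge0 ?cLnorm_ge0 ?lee_fin//.
  exact: slice2_bound.
by rewrite LnormZl.
Qed.

End on_tensor_sums.

(** Approximation of [f] by a sum [u] of tensors, cut down to [B1 `*` B2]; both
    sides of the inequality for [u] are close to those for [f]. *)
Lemma tensor_bound f : cL2 mu f -> (forall z, ~ (B1 `*` B2) z -> f z = 0) ->
  (cLnorm mu 2%:E (A f) <= (c1 * c2)%:E * mixed_norm12 mu1 mu2 p1 p2 f)%E.
Proof.
move=> fL fB; have [mf _] := fL.
have N12_fin g : cL2 mu g -> (forall z, ~ (B1 `*` B2) z -> g z = 0) ->
    mixed_norm12 mu1 mu2 p1 p2 g = (fine (mixed_norm12 mu1 mu2 p1 p2 g))%:E /\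
    fine (mixed_norm12 mu1 mu2 p1 p2 g) <= K1 * K2 * l2 mu g.
  move=> gL gB; have [mg _] := gL; have := mixed_norm12_le_L2 mg gB; rewrite cL2E// -EFinM => H.
  have E : mixed_norm12 mu1 mu2 p1 p2 g = (fine (mixed_norm12 mu1 mu2 p1 p2 g))%:E.
    rewrite fineK// ge0_fin_numE; last exact: Lnorm_ge0.
    by apply: le_lt_trans H _; rewrite ltry.
  by split => //; rewrite -lee_fin -E.
have [fE _] := N12_fin f fL fB.
have AfL := op_cL2 linA domA fL.
set N := fine (mixed_norm12 mu1 mu2 p1 p2 f) in fE.
rewrite (cL2E AfL) fE -EFinM lee_fin.
apply/ler_addgt0Pr => e e0.
have k0 : 0 < c1 * c2 * (K1 * K2) + 1 by rewrite ltr_wpDl// !mulr_ge0.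
have [I [a [b [aL bL lt1]]]] := tensor_sum_dense fL (divr_gt0 e0 k0).
pose a' i := patch (fun=> 0) B1 (a i); pose b' i := patch (fun=> 0) B2 (b i).
have aL' i : cL2 mu1 (a' i) by exact: cL2_patch.
have bL' i : cL2 mu2 (b' i) by exact: cL2_patch.
have aB' i x : ~ B1 x -> a' i x = 0 by move=> Bx; rewrite /a' /patch memNset.
have bB' i x : ~ B2 x -> b' i x = 0 by move=> Bx; rewrite /b' /patch memNset.
have bound := tensor_sum_bound aL' bL' aB' bB'.
set u := tensor_sum a' b' in bound.
have uL : cL2 mu u by exact: cL2_tensor_sum.
have uB z : ~ (B1 `*` B2) z -> u z = 0.
  move=> Bz; rewrite /u /tensor_sum big1// => i _.
  have [B1z|] := pselect (B1 z.1); last by move/aB' => ->; rewrite mul0r.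
  by rewrite bB' ?mulr0// => B2z; apply: Bz.
have fuL := cL2B fL uL.
have lt2 : l2 mu (fun z => f z - u z) < e / (c1 * c2 * (K1 * K2) + 1).
  apply: le_lt_trans lt1; have abL := cL2B fL (cL2_tensor_sum aL bL).
  rewrite -lee_fin -!cL2E//; apply: le_cLnorm => //; [by case: fuL|by case: abL|].
  move=> z; have [[B1z B2z]|Bz] := pselect ((B1 `*` B2) z).
    rewrite /u /tensor_sum; under eq_bigr do rewrite /a' /b' /patch !mem_set//.
    exact: lexx.
  by rewrite fB// uB// subrr Normc.normc0 normc_ge0.
have [uE _] := N12_fin u uL uB.
have [ufE ufle] := N12_fin (fun z => u z - f z) (cL2B uL fL)
  (fun z Bz => eq_trans (congr2 (fun s t => s - t) (uB z Bz) (fB z Bz)) (subrr 0)).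
have tri : fine (mixed_norm12 mu1 mu2 p1 p2 u) <=
    fine (mixed_norm12 mu1 mu2 p1 p2 (fun z => u z - f z)) + N.
  rewrite -lee_fin EFinD /N -fE -uE -ufE.
  have [muf _] := cL2B uL fL.
  have := mixed_norm12D p1_ge1 p2_ge1 muf mf.
  by under [X in mixed_norm12 _ _ _ _ X]eq_fun do rewrite subrK.
have AuL := op_cL2 linA domA uL.
move: bound; rewrite (cL2E AuL) uE -EFinM lee_fin => bound.
have step : l2 mu (A f) <= l2 mu (A u) + l2 mu (fun z => f z - u z).
  apply: le_trans (l2_sub_triangle AfL AuL) _; rewrite lerD2l.
  rewrite -(ae_eq_l2 _ _ (op_sub linA domA fL uL)); last 2 first.
  - exact: op_cL2.
  - exact: cL2B.
  exact: contrA.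
rewrite (l2BC uL fL) in ufle.
have e1 : (c1 * c2 * (K1 * K2) + 1) * l2 mu (fun z => f z - u z) <= e.
  by rewrite mulrC -ler_pdivlMr// ltW.
apply: le_trans step _; apply: le_trans (lerD bound (lexx _)) _.
apply: le_trans (lerD (ler_wpM2l _ tri) (lexx _)) _; first exact: mulr_ge0.
apply: le_trans (lerD (ler_wpM2l _ (lerD ufle (lexx _))) (lexx _)) _; first exact: mulr_ge0.
rewrite mulrDr -addrA addrCA lerD2l; apply: le_trans e1.
by rewrite mulrDl mul1r !mulrA lexx.
Qed.

End tensor_bound.


(** * Spectral mass of a set *)

Section spectral_indicator.
Context d d' (T : measurableType d) (S : measurableType d') (R : realType)
  (mu : {measure set T -> \bar R}) (E : set S -> operator R T).
Hypothesis specE : spectral_decomposition mu E.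

Lemma rin_i_self (f : T -> R[i]) : rin mu f (fun x => 'i%C * f x) = 0.
Proof.
have d0 x : dot f (fun x => 'i%C * f x) x = 0.
  by rewrite /dot !cReM !cImM/=; ring.
by rewrite rinE; under eq_integral do rewrite d0; rewrite integral0.
Qed.

(** The form [<E B f, f>] has real part the mass of [B] and, as [E B] is
    symmetric and idempotent, no imaginary part. *)
Lemma spectral_integral_cind (B : set S) : measurable B ->
  is_spectral_integral mu E (cind R B) (E B).
Proof.
move=> mB; split.
- exact: (spec_linear specE).
- rewrite (spec_dom specE)// (spec_bounded_dom specE)//.
    exact: cmeasurable_cind.
  exists 1 => s; rewrite normc_real indicE.
  by case: (s \in B); rewrite ?normr1 ?normr0.
rewrite (spec_dom specE)// => f fL.
have [/(_ B mB)[_ _ idem sym] _ _ _ _] := specE.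
have EfL := spec_cL2 specE mB fL; have EEfL := spec_cL2 specE mB EfL.
have ifL := cL2Z 'i%C fL.
have Im0 : complex.Im (inner mu (E B f) f) = 0.
  rewrite Im_inner -(ae_eq_rin EEfL EfL ifL (idem f fL)) -Im_inner sym//.
  by rewrite Im_inner rin_i_self.
have Re1 : complex.Re (inner mu (E B f) f) = fine (\int[spectral_measure mu E f]_s (\1_B s)%:E).
  rewrite (spec_integralE specE fL) integral_indic// setIT /= spec_measureE//=.
  by rewrite -(spec_rin specE).
have -> : inner mu (E B f) f = Complex (complex.Re (inner mu (E B f) f))
  (complex.Im (inner mu (E B f) f)) by [].
rewrite Im0 Re1 /cintegral /=; congr Complex.
by rewrite (spec_integralE specE fL) integral0.
Qed.

Lemma spec_eq0_bigcup (B : nat -> set S) (f : T -> R[i]) : (forall n, measurable (B n)) ->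
  cL2 mu f -> (forall n, E (B n) f = (fun=> 0) %[ae mu]) ->
  E (\bigcup_n B n) f = (fun=> 0) %[ae mu].
Proof.
move=> mB fL EB; have mU : measurable (\bigcup_n B n) by exact: bigcupT_measurable.
apply: l2_eq0; first exact: (spec_cL2 specE).
apply/eqP; rewrite -sqrf_eq0 -eqe -(spec_measureE specE fL)//.
apply/eqP; have : (spec_measure specE fL).-negligible (\bigcup_n B n).
  apply: negligible_bigcup => n; exists (B n); split => //.
  rewrite [LHS](spec_measureE specE fL)// (ae_eq_l2 _ _ (EB n));
    [|exact: (spec_cL2 specE)|exact: cL2_0].
  by rewrite /l2 cLnorm0//= expr0n.
by move/negligibleP => /(_ mU).
Qed.

(** A condition [E B f = 0] for all [f] may therefore be checked on a total
    set. *)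
Lemma spec_ker_closed (B : set S) : measurable B ->
  closed_subspace mu [set f | cL2 mu f /\ E B f = (fun=> 0) %[ae mu]].
Proof.
move=> mB; have linE := spec_linear specE mB; have domE := spec_dom specE mB.
split.
- by split; [exact: cL2_0|exact: (op0 linE)].
- move=> c f g [fL f0] [gL g0]; split; first exact: cL2_lin.
  apply: filterS3 (op_lin linE domE c fL gL) f0 g0 => x + + + _.
  by move=> /(_ I) -> /(_ I) -> /(_ I) ->; rewrite mulr0 addr0.
- move=> f fL happ; split => //; have EfL := op_cL2 linE domE fL.
  apply: l2_eq0 => //; apply/eqP; rewrite eq_le l2_ge0 andbT.
  apply/ler_addgt0Pr => e e0; rewrite add0r.
  have [g [[_ g0] gL ltg]] := happ e e0.
  have EgL := op_cL2 linE domE gL.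
  apply: le_trans (l2_sub_triangle EfL EgL) _.
  rewrite (ae_eq_l2 EgL (cL2_0 mu) g0) {1}/l2 cLnorm0// add0r.
  rewrite -(ae_eq_l2 _ _ (op_sub linE domE fL gL)); last 2 first.
  - by apply: (op_cL2 linE domE); exact: cL2B.
  - exact: cL2B.
  by apply: le_trans (ltW ltg); apply: (spec_contraction specE) => //; exact: cL2B.
Qed.

End spectral_indicator.

(** [A |-> k * lebesgue_measure (A / k)] agrees with Lebesgue measure on
    intervals, hence everywhere. *)
Lemma lebesgue_null_scale (R : realType) (k : R) (Z : set R) : 0 < k -> measurable Z ->
  lebesgue_measure Z = 0%E -> lebesgue_measure [set l : R | Z (k * l)] = 0%E.
Proof.
move=> k0 mZ Z0.
pose f : measurableTypeR R -> measurableTypeR R := *%R k.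
have mf : measurable_fun setT f by exact: mulrl_measurable.
pose m_of := mscale (NngNum (ltW k0)) (pushforward lebesgue_measure f) :
  {measure set (measurableTypeR R) -> \bar R}.
pose m := m_of mf.
have mE A : m A = (k%:E * lebesgue_measure [set l : R | A (k * l)%R])%E by [].
have : lebesgue_measure Z = m Z.
  apply: lebesgue_measure_unique => // _ [[a b]] _ <-; rewrite mE.
  have -> : [set l | [set` `]a, b]] (k * l)%R] = [set` `](a / k), (b / k)]].
    by apply/seteqP; split => l /=; rewrite !in_itv/= ltr_pdivrMr// ler_pdivlMr// ![l * k]mulrC.
  rewrite !lebesgue_measure_itv/= !lte_fin ltr_pM2r ?invr_gt0//.
  case: ifPn => _; last by rewrite mule0.
  by rewrite -!EFinD -EFinM; congr EFin; field; rewrite gt_eqF.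
rewrite Z0 mE => /esym/eqP; rewrite mule_eq0 eqe gt_eqF//= => /eqP.
by [].
Qed.

(** * Consequences of the restriction condition *)

Section restricted_opnorm.
Context d (T : measurableType d) (R : realType) (mu : {measure set T -> \bar R}).

(** The infimum that defines the norm is a limit of admissible constants, hence
    admissible itself. *)
Lemma restricted_opnorm_bound (p : R) (A : operator R T) (B : set T) (K : R) (f : T -> R[i]) :
  linear_operator mu A ->
  (restricted_opnorm mu (cLnorm mu p%:E) A B <= K%:E)%E -> measurable B ->
  cL2 mu f -> (cLnorm mu p%:E f < +oo)%E ->
  (cLnorm mu 2%:E (A (patch (fun=> 0%R) B f)) <= K%:E * cLnorm mu p%:E f)%E.
Proof.
move=> linA HK mB fL Nf.
have [r rE] : exists r : R, cLnorm mu p%:E f = r%:E.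
  by exists (fine (cLnorm mu p%:E f)); rewrite fineK// ge0_fin_numE// cLnorm_ge0.
have r0 : 0 <= r by rewrite -lee_fin -rE cLnorm_ge0.
have step (e : R) : 0 < e -> (cLnorm mu 2%:E (A (patch (fun=> 0%R) B f)) <= ((K + e) * r)%:E)%E.
  move=> e0.
  have /ereal_inf_lt[_ [K' [K'0 HK'] <-]] :
      (restricted_opnorm mu (cLnorm mu p%:E) A B < (K + e)%:E)%E.
    by apply: le_lt_trans HK _; rewrite lte_fin ltrDl.
  rewrite lte_fin => K'K; have [domA le1] := HK' f fL Nf.
  apply: le_trans le1 _; rewrite rE -EFinM lee_fin.
  by apply: ler_wpM2r => //; exact: ltW.
have [dA _ _ _ _] := linA.
have APL : cL2 mu (A (patch (fun=> 0%R) B f)).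
  have [_ + _ _ _] := linA; apply.
  have /ereal_inf_lt[_ [K' [K'0 HK'] <-]] :
      (restricted_opnorm mu (cLnorm mu p%:E) A B < (K + 1)%:E)%E.
    by apply: le_lt_trans HK _; rewrite lte_fin ltrDl.
  by move=> _; have [] := HK' f fL Nf.
move: step; rewrite cL2E// rE -EFinM lee_fin => step.
apply/ler_addgt0Pr => e e0.
have r1 : 0 < r + 1 by rewrite ltr_wpDl.
have := step _ (divr_gt0 e0 r1); rewrite lee_fin => /le_trans; apply.
rewrite mulrDl lerD2l mulrAC ler_pdivrMr// ler_wpM2l ?(ltW e0)// lerDl.
by [].
Qed.

End restricted_opnorm.


Lemma Linf_norm_le reading (R : realType) d (S : measurableType d)
    (m : {measure set S -> \bar R}) (F : S -> R[i]) (M : R) : 0 <= M ->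
  (forall s, Normc.normc (F s) <= M) -> (Linf_norm reading m F <= M%:E)%E.
Proof.
move=> M0 FM; case: reading => /=.
  rewrite /cLnorm unlock; case: ifPn => // _.
  by apply/ess_supP; apply: aeW => s; rewrite /comp abse_cabs /cabs lee_fin.
by apply: ge_ereal_sup => _ [s _ <-]; rewrite lee_fin.
Qed.

Lemma Linf_norm_ge0 reading (R : realType) d (S : measurableType d)
    (m : {measure set S -> \bar R}) (F : S -> R[i]) (s0 : S) :
  (0 <= Linf_norm reading m F)%E.
Proof.
case: reading => /=; first exact: Lnorm_ge0.
by apply: le_trans (cabs_ge0 F s0) _; apply: ereal_sup_ubound; exists s0.
Qed.

Lemma measurable_sqrt_preimage (R : realType) (Z : set R) : measurable Z ->
  measurable (@Num.sqrt R @^-1` Z).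
Proof. by move=> mZ; rewrite -[_ @^-1` _]setTI; exact: measurable_sqrt. Qed.

Section single_operator.
Context (reading : Linf_reading) (R : realType) d (X : metricMeasurableType R d)
  (mu : {sigma_finite_measure set X -> \bar R}) (n p : R) (L : operator R X)
  (E : set R -> operator R X) (C : R).
Hypothesis doubling : doubling_space mu n.
Hypothesis hp : 1 <= p < 2.
Hypothesis resE : spectral_resolution mu L E.
Hypothesis C0 : 0 < C.
Hypothesis HST : forall (Rad : R) (F : R -> R[i]) (A : operator R X),
  0 < Rad -> cmeasurable F -> supp F `<=` `[0, Rad] -> is_fun_sqrt mu L F A ->
  forall (x : X) (r : R), Rad^-1 <= r ->
    (restricted_opnorm mu (cLnorm mu p%:E) A (ball x r) <=
     (C * restriction_factor mu n p Rad x r)%:E *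
     Linf_norm reading lebesgue_measure (fun l : R => F (Rad * l)%R))%E.

Let specE : spectral_decomposition mu E. Proof. by case: resE. Qed.
Let p12 : 1 <= p <= 2. Proof. by case/andP: hp => -> /ltW ->. Qed.

Lemma ball_open_metric (x : X) (r : R) : open (ball x r).
Proof.
rewrite openE => y; rewrite ballEmdist /= => xy; apply/nbhs_ballP.
exists ((r - mdist x y) / 2); first by rewrite /= divr_gt0// subr_gt0.
have xy' : ball x ((mdist x y + r) / 2) y by rewrite ballEmdist/=; lra.
move=> z yz; have := ball_triangle xy' yz.
have -> : (mdist x y + r) / 2 + (r - mdist x y) / 2 = r by lra.
by rewrite ballEmdist.
Qed.

Lemma measurable_metric_ball (x : X) (r : R) : measurable (ball x r).
Proof.
have [-> _ _ _ _] := doubling; apply: sub_sigma_algebra; exact: ball_open_metric.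
Qed.

Lemma ball_fin (x : X) (r : R) : 0 < r -> (mu (ball x r) < +oo)%E.
Proof. by move=> r0; have [_ + _ _ _] := doubling; apply. Qed.

Lemma ST_opnorm (Rad : R) (Z : set R) (x : X) (r : R) : 0 < Rad -> measurable Z ->
  Z `<=` `[0, Rad] -> Rad^-1 <= r ->
  (restricted_opnorm mu (cLnorm mu p%:E) (E (@Num.sqrt R @^-1` Z)) (ball x r) <=
   (C * restriction_factor mu n p Rad x r)%:E *
   Linf_norm reading lebesgue_measure (fun l : R => cind R Z (Rad * l)%R))%E.
Proof.
move=> Rad0 mZ Zsub rRad; apply: HST => //.
- exact: cmeasurable_cind.
- rewrite /supp; apply: subset_trans (closure_subset _) _; last first.
    by rewrite -(closure_id _).1; [exact: subset_refl|exact: interval_closed].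
  move=> s /eqP; apply: contra_notP => Zs.
  by apply/eqP; rewrite eq_complex/= indicE memNset ?eqxx// => /Zsub.
- exists E; split => //.
  have -> : (fun l : R => cind R Z (Num.sqrt l)) = cind R (@Num.sqrt R @^-1` Z) by [].
  by apply: spectral_integral_cind => //; exact: measurable_sqrt_preimage.
Qed.

(** The hypothesis for the indicator of [[0, Rad]], whose norm is at most [1] in
    both readings. As [Num.sqrt] vanishes on negative numbers, the spectral
    window is the half-line []-oo, Rad ^+ 2]]. *)
Lemma ST_projection (Rad : R) (x : X) (r : R) (f : X -> R[i]) : 0 < Rad ->
  Rad^-1 <= r -> cL2 mu f -> (cLnorm mu p%:E f < +oo)%E ->
  (cLnorm mu 2%:E (E (@Num.sqrt R @^-1` `[0%R, Rad]) (patch (fun=> 0%R) (ball x r) f)) <=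
   (C * restriction_factor mu n p Rad x r)%:E * cLnorm mu p%:E f)%E.
Proof.
move=> Rad0 rRad fL fp; have mI : measurable (`[0, Rad]%classic : set R) by [].
apply: restricted_opnorm_bound => //.
- by apply: (spec_linear specE); exact: measurable_sqrt_preimage.
- apply: le_trans (ST_opnorm x Rad0 mI (@subset_refl _ _) rRad) _.
  apply: (@le_trans _ _ ((C * restriction_factor mu n p Rad x r)%:E * 1)%E); last by rewrite mule1.
  apply: lee_wpmul2l; first by rewrite lee_fin mulr_ge0 ?powR_ge0 ?(ltW C0).
  apply: Linf_norm_le => // s; rewrite normc_real indicE.
  by case: (_ \in _); rewrite ?normr1 ?normr0.
- exact: measurable_metric_ball.
Qed.

(** In the reading as an essential supremum, the indicator of a null set of
    frequencies has norm [0]. The hypothesis then kills every function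
    supported in a ball, and these are dense. *)
Lemma ST_null_bounded (Z : set R) (k : R) (f : X -> R[i]) : reading = Linf_ess ->
  0 < k -> measurable Z -> lebesgue_measure Z = 0%E -> Z `<=` `[0, k] -> cL2 mu f ->
  E (@Num.sqrt R @^-1` Z) f = (fun=> 0) %[ae mu].
Proof.
move=> ess k0 mZ Z0 Zk fL.
have mZ' := measurable_sqrt_preimage mZ.
have cV := spec_ker_closed specE mZ'.
have [x|] := pselect (exists x : X, True); last first.
  by move=> nX; apply: aeW => x; exfalso; apply: nX; exists x.
have {x}[x _] := x.
(* radii that satisfy the constraint of the hypothesis and exhaust the space *)
pose rad i : R := k^-1 + i%:R.
have rad0 i : 0 < rad i by rewrite ltr_pwDl ?invr_gt0.
have local i : E (@Num.sqrt R @^-1` Z) (patch (fun=> 0) (ball x (rad i)) f) = (fun=> 0) %[ae mu].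
  have mB := measurable_metric_ball x (rad i).
  set g := patch _ _ f; have gL : cL2 mu g by exact: cL2_patch.
  have [K K0 HK] := Lnorm_le_L2 p12 mB (ball_fin x (rad0 i)).
  have gB y : ~ ball x (rad i) y -> g y = 0 by move=> By; rewrite /g /patch memNset.
  have gp : (cLnorm mu p%:E g < +oo)%E.
    apply: le_lt_trans (HK _ _ _) _.
    - by apply: measurable_cabs; case: gL.
    - by move=> y /gB; rewrite /cabs => ->; rewrite Normc.normc0.
    - by rewrite lte_mul_pinfty ?lee_fin//; case: gL.
  have gg : patch (fun=> 0) (ball x (rad i)) g = g.
    by apply/funext => y; rewrite /g /patch; case: (y \in _).
  have := @restricted_opnorm_bound _ _ _ mu p (E (@Num.sqrt R @^-1` Z)) (ball x (rad i)) 0 g.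
  move=> /(_ (spec_linear specE mZ')) H.
  apply: (@cLnorm_eq0 _ _ _ mu _ 2) => //.
    by have [] := spec_cL2 specE mZ' gL.
  apply/eqP; rewrite eq_le cLnorm_ge0 andbT -[leRHS](mul0e (cLnorm mu p%:E g)) -{1}gg.
  apply: H => //.
  apply: le_trans (ST_opnorm (Rad := k) _ _ _ _ _) _ => //; first by rewrite lerDl.
  rewrite ess /=.
  have -> : (cLnorm lebesgue_measure +oo (fun l : R => cind R Z (k * l)%R) = 0)%E.
    have mkZ : measurable [set l : R | Z (k * l)].
      by rewrite -[X in measurable X]setTI; exact: (@mulrl_measurable R setT k measurableT _ mZ).
    apply/eqP; rewrite eq_le Lnorm_ge0 andbT /cLnorm unlock; case: ifPn => // _.
    apply/ess_supP; exists [set l : R | Z (k * l)]; split => //.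
      exact: lebesgue_null_scale.
    move=> l; apply: contra_notP => Zl.
    change (`|cabs (cind R Z) (k * l)%R|%E <= 0)%E.
    by rewrite /cabs normc_real indicE memNset// normr0 abse0.
  by rewrite mule0.
have [] : [set f | cL2 mu f /\ E (@Num.sqrt R @^-1` Z) f = (fun=> 0) %[ae mu]] f => //.
apply: (closed_dominated cV (f_ := fun i => patch (fun=> 0) (ball x (rad i)) f)) => //.
- by move=> i; split; [apply: cL2_patch => //; exact: measurable_metric_ball|exact: local].
- by move=> i; apply: cL2_patch => //; exact: measurable_metric_ball.
- move=> y; apply: cvg_near_cst; exists (Num.truncn (mdist x y)).+1 => // i yi.
  rewrite /patch mem_set ?subrr ?Normc.normc0// ballEmdist /=.
  apply: lt_le_trans (truncnS_gt _) _; apply: (@le_trans _ _ (i%:R)); first by rewrite ler_nat.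
  by rewrite lerDr invr_ge0 ltW.
- move=> i y; rewrite /patch; case: ifPn => _; last by rewrite subr0.
  by rewrite subrr Normc.normc0 normc_ge0.
Qed.

(** [Z] is cut into bounded pieces. The division by [k] accounts for the
    dilation in the two-parameter estimates. *)
Lemma ST_null (Z : set R) (k : R) (f : X -> R[i]) : reading = Linf_ess -> 0 < k ->
  measurable Z -> lebesgue_measure Z = 0%E -> cL2 mu f ->
  E [set l : R | Z (Num.sqrt l / k)] f = (fun=> 0) %[ae mu].
Proof.
move=> ess k0 mZ Z0 fL.
have k1 : 0 < k^-1 by rewrite invr_gt0.
pose Z' := [set l : R | Z (k^-1 * l)].
have mZ' : measurable Z'.
  by rewrite -[Z']setTI; exact: (@mulrl_measurable R setT k^-1 measurableT _ mZ).
have Z'0 : lebesgue_measure Z' = 0%E by exact: lebesgue_null_scale.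
pose Zn i := Z' `&` `[0, i.+1%:R]%classic.
have mZn i : measurable (Zn i) by apply: measurableI.
have -> : [set l : R | Z (Num.sqrt l / k)] = \bigcup_i (@Num.sqrt R @^-1` (Zn i)).
  apply/seteqP; split => l /=; last by move=> [i _ [/= + _]]; rewrite /Z'/= mulrC.
  move=> Zl; exists (Num.truncn (Num.sqrt l)) => //; split; rewrite /Z'/= ?in_itv/=.
    by rewrite mulrC.
  by rewrite sqrtr_ge0 ltW// truncnS_gt.
apply: (spec_eq0_bigcup specE) => // i; first by exact: measurable_sqrt_preimage.
apply: (@ST_null_bounded _ i.+1%:R) => //; last exact: subIsetr.
apply/eqP; rewrite eq_le measure_ge0 andbT.
apply: (@le_trans _ _ (lebesgue_measure Z')); last by rewrite Z'0.
by apply: le_measure; [rewrite inE; exact: mZn|rewrite inE|exact: subIsetl].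
Qed.

Lemma ST_projection_supported (Rad : R) (x : X) (r : R) (f : X -> R[i]) : 0 < Rad ->
  Rad^-1 <= r -> cL2 mu f -> (forall y, ~ ball x r y -> f y = 0) ->
  (cLnorm mu 2%:E (E (@Num.sqrt R @^-1` `[0%R, Rad]) f) <=
   (C * restriction_factor mu n p Rad x r)%:E * cLnorm mu p%:E f)%E.
Proof.
move=> Rad0 rRad fL fB.
have r0 : 0 < r by apply: lt_le_trans rRad; rewrite invr_gt0.
have [K K0 HK] := Lnorm_le_L2 p12 (measurable_metric_ball x r) (ball_fin x r0).
have fp : (cLnorm mu p%:E f < +oo)%E.
  apply: le_lt_trans (HK _ _ _) _.
  - by apply: measurable_cabs; case: fL.
  - by move=> y /fB; rewrite /cabs => ->; rewrite Normc.normc0.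
  - by rewrite lte_mul_pinfty ?lee_fin//; case: fL.
have := ST_projection x Rad0 rRad fL fp; congr (cLnorm _ _ (E _ _) <= _)%E.
apply/funext => y; rewrite /patch; have [//|] := boolP (y \in _).
by rewrite notin_setE => /fB.
Qed.

End single_operator.


(** * The joint spectral decomposition *)

Section joint.
Context (R : realType) d1 d2 (T1 : measurableType d1) (T2 : measurableType d2).
Variables (mu1 : {sigma_finite_measure set T1 -> \bar R})
  (mu2 : {sigma_finite_measure set T2 -> \bar R}).
Variables (E1 : set R -> operator R T1) (E2 : set R -> operator R T2)
  (E : set (R * R) -> operator R (T1 * T2)).
Hypotheses (specE1 : spectral_decomposition mu1 E1)
  (specE2 : spectral_decomposition mu2 E2) (joint : joint_decomposition mu1 mu2 E1 E2 E).
Local Notation mu := (mu1 \x mu2)%E.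

Let specE : spectral_decomposition mu E. Proof. by case: joint. Qed.

(** On an elementary tensor the joint spectral measure is the product of the two
    scalar spectral measures, so Fubini's theorem applies: almost every section
    of [N] is null, hence without mass for the second measure, and the
    exceptional sections form a null set, hence without mass for the first. *)
Lemma joint_null (g1 g2 : R -> R) (N : set (R * R)) (f : T1 * T2 -> R[i]) :
  measurable_fun [set: R] g1 -> measurable_fun [set: R] g2 ->
  (forall (Z : set R) h, measurable Z -> lebesgue_measure Z = 0%E -> cL2 mu1 h ->
    E1 (g1 @^-1` Z) h = (fun=> 0) %[ae mu1]) ->
  (forall (Z : set R) h, measurable Z -> lebesgue_measure Z = 0%E -> cL2 mu2 h ->
    E2 (g2 @^-1` Z) h = (fun=> 0) %[ae mu2]) ->
  measurable N -> (lebesgue_measure \x lebesgue_measure)%E N = 0%E -> cL2 mu f ->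
  E [set l | N (g1 l.1, g2 l.2)] f = (fun=> 0) %[ae mu].
Proof.
move=> mg1 mg2 H1 H2 mN N0 fL; set N' := [set l | _].
have mN' : measurable N'.
  rewrite -[N']setTI.
  have mg : measurable_fun [set: R * R] (fun l => (g1 l.1, g2 l.2)).
    by apply/measurable_fun_pair; [exact: (measurableT_comp mg1)|exact: (measurableT_comp mg2)].
  exact: mg.
suff [] : [set f | cL2 mu f /\ E N' f = (fun=> 0) %[ae mu]] f by [].
apply: tensor_induction fL; first exact: (spec_ker_closed specE).
move=> f1 f2 f1L f2L; have fL := cL2_tensor f1L f2L; split => //.
apply: l2_eq0; first exact: (spec_cL2 specE).
apply/eqP; rewrite -sqrf_eq0 -eqe -(spec_measureE specE fL)//; apply/eqP.
have prodE A B : measurable A -> measurable B -> spec_measure specE fL (A `*` B) =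
    (spec_measure specE1 f1L A * spec_measure specE2 f2L B)%E.
  move=> mA mB; rewrite !spec_measureE//; last exact: measurableX.
  have [_ /(_ A B f1 f2 mA mB f1L f2L) EAB] := joint.
  have E1L := spec_cL2 specE1 mA f1L; have E2L := spec_cL2 specE2 mB f2L.
  rewrite (ae_eq_l2 _ _ EAB);
    [|by apply: (spec_cL2 specE) => //; exact: measurableX|exact: cL2_tensor].
  by rewrite l2_tensor// exprMn EFinM.
rewrite -(product_measure_unique prodE)//.
rewrite /product_measure1.
have : ae_eq lebesgue_measure setT (fun s => lebesgue_measure (xsection N s)) (cst 0%E).
  apply/ae_eq_integral_abs => //; first exact: measurable_fun_xsection.
  rewrite -[RHS]N0 /product_measure1; apply: eq_integral => s _.
  by rewrite gee0_abs.
move=> [Z [mZ Z0 NZ]].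
rewrite (ae_eq_integral (cst 0%E))//; first by rewrite integral0.
  exact: measurable_fun_xsection.
exists (g1 @^-1` Z); split.
- by rewrite -[_ @^-1` _]setTI; exact: mg1.
- rewrite [LHS](spec_measureE specE1 f1L); last by rewrite -[_ @^-1` _]setTI; exact: mg1.
  rewrite (ae_eq_l2 _ (cL2_0 mu1) (H1 _ _ mZ Z0 f1L)); first by rewrite /l2 cLnorm0//= expr0n.
  by apply: (spec_cL2 specE1) => //; rewrite -[_ @^-1` _]setTI; exact: mg1.
move=> l /=; apply: contra_notP => nZ _.
have sN0 : lebesgue_measure (xsection N (g1 l)) = 0%E.
  by apply: contrapT => h; apply: nZ; apply: NZ => /= /(_ I).
have -> : xsection N' l = g2 @^-1` (xsection N (g1 l)).
  by apply/seteqP; split => t; rewrite /xsection /= !inE.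
have mx : measurable (xsection N (g1 l)) by exact: measurable_xsection.
have mgx : measurable (g2 @^-1` (xsection N (g1 l))) by rewrite -[_ @^-1` _]setTI; exact: mg2.
rewrite [LHS](spec_measureE specE2 f2L)//.
rewrite (ae_eq_l2 _ (cL2_0 mu2) (H2 _ _ mx sN0 f2L)); first by rewrite /l2 cLnorm0//= expr0n.
exact: (spec_cL2 specE2).
Qed.

(** For the genuine supremum the exceptional set [N] is empty; for the essential
    supremum it is where [|F|] exceeds it, and [joint_null] applies. *)
Lemma joint_sup_bound (reading : Linf_reading) (F : R * R -> R[i]) (R1 R2 : R) : 0 < R1 -> 0 < R2 ->
  cmeasurable F -> cbounded F ->
  (reading = Linf_ess ->
    (forall (Z : set R) h, measurable Z -> lebesgue_measure Z = 0%E -> cL2 mu1 h ->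
      E1 [set l | Z (Num.sqrt l / R1)] h = (fun=> 0) %[ae mu1]) /\
    (forall (Z : set R) h, measurable Z -> lebesgue_measure Z = 0%E -> cL2 mu2 h ->
      E2 [set l | Z (Num.sqrt l / R2)] h = (fun=> 0) %[ae mu2])) ->
  exists (M : R) (N : set (R * R)), [/\
    0 <= M, measurable N,
    Linf_norm reading (lebesgue_measure \x lebesgue_measure)%E (dilate (R1, R2) F) = M%:E,
    forall f, cL2 mu f -> E N f = (fun=> 0) %[ae mu] &
    forall l, ~ N l -> Normc.normc (F (Num.sqrt l.1, Num.sqrt l.2)) <= M].
Proof.
move=> R10 R20 mF [Mb FMb] Hnull.
set m := (_ \x _)%E; set LF := Linf_norm _ _ _.
have mD : cmeasurable (dilate (R1, R2) F).
  apply: (cmeasurable_comp mF); apply/measurable_fun_pair => /=.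
    by apply: measurable_funM; [exact: measurable_cst|exact: measurable_fst].
  by apply: measurable_funM; [exact: measurable_cst|exact: measurable_snd].
have LF0 : (0 <= LF)%E by apply: Linf_norm_ge0; exact: ((0, 0) : R * R).
have LFfin : LF \is a fin_num.
  rewrite ge0_fin_numE//; apply: le_lt_trans (ltry (Num.max Mb 0)).
  apply: Linf_norm_le; first by rewrite le_max lexx orbT.
  by move=> s; rewrite le_max FMb.
have undil l : F (Num.sqrt l.1, Num.sqrt l.2) =
    dilate (R1, R2) F (Num.sqrt l.1 / R1, Num.sqrt l.2 / R2).
  by rewrite /dilate/= !mulrA ![_ * Num.sqrt _]mulrC !mulfK// gt_eqF.
case: reading => [|] in Hnull LF LF0 LFfin *; last first.
  exists (fine LF), set0; split; rewrite ?fine_ge0 ?fineK//.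
  - by move=> f fL; have [_ /(_ f fL)] := specE.
  - move=> l _; rewrite -lee_fin fineK// undil.
    by apply: ereal_sup_ubound; exists (Num.sqrt l.1 / R1, Num.sqrt l.2 / R2).
have [H1 H2] := Hnull erefl.
pose N0 := [set l | (LF < cabs (dilate (R1, R2) F) l)%E].
have mN0 : measurable N0.
  rewrite -[N0]setTI; apply: emeasurable_fun_o_infty => //.
  exact: measurable_cabs.
have mg (k : R) : measurable_fun [set: R] (fun l : R => Num.sqrt l / k).
  by apply: measurable_funM; [exact: measurable_sqrt|exact: measurable_cst].
exists (fine LF), [set l | N0 (Num.sqrt l.1 / R1, Num.sqrt l.2 / R2)].
split; rewrite ?fine_ge0 ?fineK//.
- rewrite -[X in measurable X]setTI.
  have mgg : measurable_fun [set: R * R] (fun l : R * R => (Num.sqrt l.1 / R1, Num.sqrt l.2 / R2)).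
    by apply/measurable_fun_pair; [exact: (measurableT_comp (mg R1))|
                                     exact: (measurableT_comp (mg R2))].
  exact: mgg.
- move=> f; apply: (joint_null (mg R1) (mg R2)) => //.
  have : (m).-negligible N0.
    have N0E : N0 = ~` [set l | (cabs (dilate (R1, R2) F) l <= LF)%E].
      apply/seteqP; split => l; rewrite /N0 /mkset ltNge => /negP//.
    have : \forall l \ae m, (cabs (dilate (R1, R2) F) l <= LF)%E.
      rewrite /LF /Linf_norm /cLnorm unlock; case: ifPn => [_|].
        apply: filterS (ess_sup_ge m (abse \o cabs (dilate (R1, R2) F))) => l.
        by rewrite /comp abse_cabs.
      rewrite -leNgt => mT; exists setT; split => //.
      by apply/eqP; rewrite eq_le mT measure_ge0.
    by rewrite N0E.
  by move/negligibleP => /(_ mN0).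
- by move=> l /negP; rewrite -leNgt -lee_fin fineK// undil.
Qed.

End joint.


(** * The two-parameter estimates *)

Section mixed_norms.
Context (R : realType) d1 d2 (T1 : measurableType d1) (T2 : measurableType d2).
Variables (mu1 : {sigma_finite_measure set T1 -> \bar R})
  (mu2 : {sigma_finite_measure set T2 -> \bar R}).

Lemma le_mixed_norm12 (p q : R) (f g : T1 * T2 -> R[i]) : 0 <= p -> 0 <= q ->
  cmeasurable f -> cmeasurable g ->
  (forall z, Normc.normc (f z) <= Normc.normc (g z)) ->
  (mixed_norm12 mu1 mu2 p q f <= mixed_norm12 mu1 mu2 p q g)%E.
Proof.
move=> p0 q0 mf mg fg.
apply: le_Lnorm => //; do ?exact: measurable_cLnorm_slice1.
move=> x; rewrite !gee0_abs ?cLnorm_ge0//.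
by apply: le_cLnorm => //; exact: cmeasurable_slice1.
Qed.

Lemma le_mixed_norm21 (p q : R) (f g : T1 * T2 -> R[i]) : 0 <= p -> 0 <= q ->
  cmeasurable f -> cmeasurable g ->
  (forall z, Normc.normc (f z) <= Normc.normc (g z)) ->
  (mixed_norm21 mu1 mu2 p q f <= mixed_norm21 mu1 mu2 p q g)%E.
Proof.
move=> p0 q0 mf mg fg.
apply: le_Lnorm => //; do ?exact: measurable_cLnorm_slice2.
move=> y; rewrite !gee0_abs ?cLnorm_ge0//.
by apply: le_cLnorm => //; exact: cmeasurable_slice2.
Qed.

(** Minkowski's integral inequality with the two factors exchanged. *)
Lemma mixed_norm12_le21 (p : R) (f : T1 * T2 -> R[i]) : 1 <= p <= 2 ->
  cmeasurable f -> (mixed_norm12 mu1 mu2 2 p f < +oo)%E ->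
  (mixed_norm12 mu1 mu2 2 p f <= mixed_norm21 mu1 mu2 p 2 f)%E.
Proof.
move=> hp mf fin.
have mh : measurable_fun [set: T2 * T1] (fun z => cabs f (z.2, z.1)).
  have ms : measurable_fun [set: T2 * T1] (fun z : T2 * T1 => (z.2, z.1)).
    by apply/measurable_fun_pair; [exact: measurable_snd|exact: measurable_fst].
  exact: (measurableT_comp (measurable_cabs mf) ms).
exact: (Lnorm_swap (mu1 := mu2) (mu2 := mu1) hp mh fin).
Qed.

End mixed_norms.

Lemma restricted_opnorm_le d (T : measurableType d) (R : realType)
    (mu : {measure set T -> \bar R}) (N : (T -> R[i]) -> \bar R) (A : operator R T)
    (B : set T) (K : R) : 0 <= K ->
  (forall f, cL2 mu f -> (N f < +oo)%E -> dom A (patch (fun=> 0) B f) /\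
    (cLnorm mu 2%:E (A (patch (fun=> 0%R) B f)) <= K%:E * N f)%E) ->
  (restricted_opnorm mu N A B <= K%:E)%E.
Proof. by move=> K0 HK; apply: ereal_inf_lbound; exists K. Qed.

Section joint_estimate.
Context (R : realType) d1 d2 (T1 : measurableType d1) (T2 : measurableType d2).
Variables (mu1 : {sigma_finite_measure set T1 -> \bar R})
  (mu2 : {sigma_finite_measure set T2 -> \bar R}).
Variables (E1 : set R -> operator R T1) (E2 : set R -> operator R T2)
  (E : set (R * R) -> operator R (T1 * T2)).
Hypotheses (specE1 : spectral_decomposition mu1 E1)
  (specE2 : spectral_decomposition mu2 E2) (joint : joint_decomposition mu1 mu2 E1 E2 E).
Local Notation mu := (mu1 \x mu2)%E.
Variables (F : R * R -> R[i]) (A : operator R (T1 * T2)).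
Hypothesis intA : is_spectral_integral mu E F A.
Hypotheses (mF : cmeasurable F) (bF : cbounded F).
Variables (M : R) (N : set (R * R)) (S1 S2 : set R).
Hypotheses (M0 : 0 <= M) (mN : measurable N) (mS1 : measurable S1) (mS2 : measurable S2).
Hypothesis EN : forall f, cL2 mu f -> E N f = (fun=> 0) %[ae mu].
Hypothesis FM : forall l, ~ N l -> Normc.normc (F l) <= M.
Hypothesis FS : forall l, ~ (S1 `*` S2) l -> F l = 0.
Variables (p1 p2 : R) (B1 : set T1) (B2 : set T2) (K1 K2 c1 c2 : R).
Hypotheses (hp1 : 1 <= p1 <= 2) (hp2 : 1 <= p2 <= 2).
Hypotheses (mB1 : measurable B1) (mB2 : measurable B2) (K10 : 0 <= K1) (K20 : 0 <= K2).
Hypothesis dom1 : forall f : T1 -> \bar R, measurable_fun [set: T1] f ->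
  (forall x, ~ B1 x -> f x = 0%E) -> ('N[mu1]_p1%:E[f] <= K1%:E * 'N[mu1]_2%:E[f])%E.
Hypothesis dom2 : forall f : T2 -> \bar R, measurable_fun [set: T2] f ->
  (forall x, ~ B2 x -> f x = 0%E) -> ('N[mu2]_p2%:E[f] <= K2%:E * 'N[mu2]_2%:E[f])%E.
Hypotheses (c10 : 0 <= c1) (c20 : 0 <= c2).
Hypothesis bnd1 : forall f, cL2 mu1 f -> (forall x, ~ B1 x -> f x = 0) ->
  (cLnorm mu1 2%:E (E1 S1 f) <= c1%:E * cLnorm mu1 p1%:E f)%E.
Hypothesis bnd2 : forall f, cL2 mu2 f -> (forall x, ~ B2 x -> f x = 0) ->
  (cLnorm mu2 2%:E (E2 S2 f) <= c2%:E * cLnorm mu2 p2%:E f)%E.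

(** The constants [c1] and [c2] are left abstract so as to cover a variable
    localized to a ball and one that is not. *)
Lemma joint_estimate f : cL2 mu f -> let PBf := patch (fun=> 0) (B1 `*` B2) f in
  [/\ dom A PBf, cL2 mu PBf,
    (mixed_norm12 mu1 mu2 p1 p2 PBf < +oo)%E &
    (cLnorm mu 2%:E (A PBf) <= (4 * M * (c1 * c2))%:E * mixed_norm12 mu1 mu2 p1 p2 PBf)%E].
Proof.
move=> fL PBf; have [specE ET] := joint.
have mB : measurable (B1 `*` B2) by exact: measurableX.
have mS : measurable (S1 `*` S2) by exact: measurableX.
have PL : cL2 mu PBf by exact: cL2_patch.
have [mP Poo] := PL.
have PB z : ~ (B1 `*` B2) z -> PBf z = 0 by move=> Bz; rewrite /PBf /patch memNset.
have domA := spec_integral_dom specE intA mF bF.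
have [linA _ _] := intA.
split => //; first by rewrite domA.
  apply: le_lt_trans (mixed_norm12_le_L2 hp1 K20 dom1 dom2 mP PB) _ => //.
  by rewrite lte_mul_pinfty ?lee_fin ?mulr_ge0.
have H1 := spec_integral_bound specE intA mF M0 mN mS EN FM FS bF PL.
apply: (@le_trans _ _ ((4 * M)%:E * cLnorm mu 2%:E (E (S1 `*` S2) PBf))%E).
  rewrite (cL2E (op_cL2 linA domA PL)) (cL2E (spec_cL2 specE mS PL)) -EFinM lee_fin.
  exact: H1.
rewrite (EFinM (4 * M)) -muleA; apply: lee_wpmul2l; first by rewrite lee_fin mulr_ge0.
apply: (tensor_bound hp1 hp2 mB1 mB2 K10 K20 dom1 dom2
  (spec_linear specE1 mS1) (spec_dom specE1 mS1)
  (spec_linear specE2 mS2) (spec_dom specE2 mS2)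
  (spec_linear specE mS) (spec_dom specE mS)) => //.
- by move=> f1 f2 f1L f2L; exact: ET.
- by move=> g gL; exact: (spec_contraction specE).
Qed.

End joint_estimate.

Lemma Lnorm_dom_id d (T : measurableType d) (R : realType)
    (mu : {measure set T -> \bar R}) (f : T -> \bar R) :
  ('N[mu]_2%:E[f] <= 1%:E * 'N[mu]_2%:E[f])%E.
Proof. by rewrite mul1e. Qed.

Lemma spec_setT_bound d d' (T : measurableType d) (S : measurableType d') (R : realType)
    (mu : {measure set T -> \bar R}) (E : set S -> operator R T) (f : T -> R[i]) :
  spectral_decomposition mu E -> cL2 mu f ->
  (cLnorm mu 2%:E (E setT f) <= 1%:E * cLnorm mu 2%:E f)%E.
Proof.
move=> specE fL; rewrite mul1e (cL2E fL) (cL2E (spec_cL2 specE measurableT fL)) lee_fin.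
exact: (spec_contraction specE).
Qed.

Lemma supp_zero (R : realType) (F : R * R -> R[i]) (D : set (R * R)) l :
  supp F `<=` D -> ~ D l -> F l = 0.
Proof.
move=> FD; apply: contra_notP => /eqP Fl; apply: FD; exact: subset_closure.
Qed.

Theorem lemma5p2 (reading : Linf_reading) (R : realType)
    (d1 d2 : measure_display)
    (X1 : metricMeasurableType R d1) (X2 : metricMeasurableType R d2)
    (mu1 : {sigma_finite_measure set X1 -> \bar R})
    (mu2 : {sigma_finite_measure set X2 -> \bar R})
    (n1 n2 p1 p2 : R) (L1 : operator R X1) (L2 : operator R X2)
    (doubling1 : doubling_space mu1 n1) (doubling2 : doubling_space mu2 n2)
    (hp1 : 1 <= p1 < 2) (hp2 : 1 <= p2 < 2)
    (hL1 : nonneg_self_adjoint mu1 L1) (hL2 : nonneg_self_adjoint mu2 L2)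
    (ST1 : ST_inf reading mu1 n1 p1 L1) (ST2 : ST_inf reading mu2 n2 p2 L2) :
  exists2 C : R, 0 < C &
    [/\ forall (R1 R2 : R) (F : R * R -> R[i]) (A : operator R (X1 * X2)),
          0 < R1 -> 0 < R2 -> cmeasurable F -> cbounded F ->
          supp F `<=` `[0, R1] `*` `[0, R2] ->
          is_joint_fun_sqrt mu1 mu2 L1 L2 F A ->
          forall (x1 : X1) (x2 : X2) (r1 r2 : R), R1^-1 <= r1 -> R2^-1 <= r2 ->
            (restricted_opnorm (mu1 \x mu2) (mixed_norm12 mu1 mu2 p1 p2) A
               (ball x1 r1 `*` ball x2 r2) <=
             (C * (restriction_factor mu1 n1 p1 R1 x1 r1 *
                   restriction_factor mu2 n2 p2 R2 x2 r2))%:E *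
             Linf_norm reading (lebesgue_measure \x lebesgue_measure)
               (dilate (R1, R2) F))%E,
        forall (R1 : R) (F : R * R -> R[i]) (A : operator R (X1 * X2)),
          0 < R1 -> cmeasurable F -> cbounded F ->
          supp F `<=` `[0, R1] `*` `[0, +oo[ ->
          is_joint_fun_sqrt mu1 mu2 L1 L2 F A ->
          forall (x1 : X1) (r1 : R), R1^-1 <= r1 ->
            (restricted_opnorm (mu1 \x mu2) (mixed_norm12 mu1 mu2 p1 2) A
               (ball x1 r1 `*` setT) <=
             (C * restriction_factor mu1 n1 p1 R1 x1 r1)%:E *
             Linf_norm reading (lebesgue_measure \x lebesgue_measure)
               (dilate (R1, 1)%R F))%E
      & forall (R2 : R) (F : R * R -> R[i]) (A : operator R (X1 * X2)),
          0 < R2 -> cmeasurable F -> cbounded F ->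
          supp F `<=` `[0, +oo[ `*` `[0, R2] ->
          is_joint_fun_sqrt mu1 mu2 L1 L2 F A ->
          forall (x2 : X2) (r2 : R), R2^-1 <= r2 ->
            (restricted_opnorm (mu1 \x mu2) (mixed_norm21 mu1 mu2 p2 2) A
               (setT `*` ball x2 r2) <=
             (C * restriction_factor mu2 n2 p2 R2 x2 r2)%:E *
             Linf_norm reading (lebesgue_measure \x lebesgue_measure)
               (dilate (1, R2)%R F))%E].
Proof.
case: ST1 => C1 C10 HST1; case: ST2 => C2 C20 HST2.
have C1ge0 := ltW C10; have C2ge0 := ltW C20.
have C1g : 0 <= C1 + 1 by rewrite ltW// ltr_wpDl// ltW.
have C2g : 0 <= C2 + 1 by rewrite ltW// ltr_wpDl// ltW.
exists (4 * ((C1 + 1) * (C2 + 1))).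
  by rewrite !mulr_gt0// ltr_wpDl// ltW.
have p12 : 1 <= p1 <= 2 by case/andP: hp1 => -> /ltW ->.
have p22 : 1 <= p2 <= 2 by case/andP: hp2 => -> /ltW ->.
have h2 : 1 <= (2 : R) <= 2 by rewrite lexx ler1n.
have facge n p Rad d (X : metricMeasurableType R d) (m : {measure set X -> \bar R}) x r :
    0 <= restriction_factor m n p Rad x r by exact: powR_ge0.
have mSq : measurable_fun [set: R * R] (fun l : R * R => (Num.sqrt l.1, Num.sqrt l.2)).
  apply/measurable_fun_pair.
    by apply: (measurableT_comp (@measurable_sqrt R)); exact: measurable_fst.
  by apply: (measurableT_comp (@measurable_sqrt R)); exact: measurable_snd.
have mI (k : R) : measurable (@Num.sqrt R @^-1` `[0, k]) by exact: measurable_sqrt_preimage.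
have patch_mixed12 (p q : R) (B : set (X1 * X2)) f : 0 <= p -> 0 <= q ->
    measurable B -> cL2 (mu1 \x mu2)%E f ->
    (mixed_norm12 mu1 mu2 p q (patch (fun=> 0%R) B f) <= mixed_norm12 mu1 mu2 p q f)%E.
  move=> p0 q0 mB fL; have [mf _] := fL; have [mP _] := cL2_patch mB fL.
  apply: le_mixed_norm12 => // z; rewrite /patch; case: ifPn => // _.
  by rewrite Normc.normc0 normc_ge0.
have p10 : 0 <= p1 by case/andP: p12 => /(le_trans ler01).
have p20 : 0 <= p2 by case/andP: p22 => /(le_trans ler01).
(* the dilation factor is [1] in a variable without localization *)
have prep (R1 R2 : R) (F : R * R -> R[i]) E1 E2 E : 0 < R1 -> 0 < R2 ->
    spectral_resolution mu1 L1 E1 -> spectral_resolution mu2 L2 E2 ->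
    joint_decomposition mu1 mu2 E1 E2 E -> cmeasurable F -> cbounded F ->
    [/\ spectral_decomposition mu1 E1, spectral_decomposition mu2 E2,
      cmeasurable (fun l : R * R => F (Num.sqrt l.1, Num.sqrt l.2)),
      cbounded (fun l : R * R => F (Num.sqrt l.1, Num.sqrt l.2)) &
    exists (M : R) (N : set (R * R)), [/\
      0 <= M, measurable N,
      Linf_norm reading (lebesgue_measure \x lebesgue_measure)%E (dilate (R1, R2) F) = M%:E,
      forall f, cL2 (mu1 \x mu2)%E f -> E N f = (fun=> 0) %[ae (mu1 \x mu2)%E] &
      forall l, ~ N l -> Normc.normc (F (Num.sqrt l.1, Num.sqrt l.2)) <= M]].
  move=> R10 R20 res1 res2 joint mF bF; have [sp1 _] := res1; have [sp2 _] := res2.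
  split => //.
  - exact: (cmeasurable_comp mF mSq).
  - by have [Mb FMb] := bF; exists Mb => l.
  apply: (joint_sup_bound sp1 sp2 joint) => // ess.
  split=> Z h mZ Z0 hL.
    exact: (ST_null doubling1 hp1 res1 HST1 ess R10 mZ Z0 hL).
  exact: (ST_null doubling2 hp2 res2 HST2 ess R20 mZ Z0 hL).
split.
- move=> R1 R2 F A R10 R20 mF bF sF [E1 [E2 [E [res1 res2 joint intA]]]] x1 x2 r1 r2 hr1 hr2.
  have [sp1 sp2 mG bG [M [N [M0 mN -> EN GM]]]] := prep _ _ _ _ _ _ R10 R20 res1 res2 joint mF bF.
  have r10 : 0 < r1 by apply: lt_le_trans hr1; rewrite invr_gt0.
  have r20 : 0 < r2 by apply: lt_le_trans hr2; rewrite invr_gt0.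
  have mB1 := measurable_metric_ball doubling1 x1 r1.
  have mB2 := measurable_metric_ball doubling2 x2 r2.
  have [K1 K10 dom1] := Lnorm_le_L2 p12 mB1 (ball_fin doubling1 x1 r10).
  have [K2 K20 dom2] := Lnorm_le_L2 p22 mB2 (ball_fin doubling2 x2 r20).
  set f1 := restriction_factor mu1 _ _ _ _ _; set f2 := restriction_factor mu2 _ _ _ _ _.
  have f10 : 0 <= f1 by exact: facge. have f20 : 0 <= f2 by exact: facge.
  have c10 : 0 <= C1 * f1 by rewrite mulr_ge0// ltW.
  have c20 : 0 <= C2 * f2 by rewrite mulr_ge0// ltW.
  have GS l : ~ ((@Num.sqrt R @^-1` `[0, R1]) `*` (@Num.sqrt R @^-1` `[0, R2])) l ->
      F (Num.sqrt l.1, Num.sqrt l.2) = 0 by move=> Sl; apply: (supp_zero sF).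
  rewrite -EFinM; apply: restricted_opnorm_le; first by rewrite !mulr_ge0.
  move=> f fL _.
  have [domA PL _ est] := joint_estimate sp1 sp2 joint intA mG bG M0 mN (mI R1) (mI R2) EN GM GS
    p12 p22 mB1 mB2 K10 K20 dom1 dom2 c10 c20
    (fun g gL gB => ST_projection_supported doubling1 hp1 res1 C10 HST1 R10 hr1 gL gB)
    (fun g gL gB => ST_projection_supported doubling2 hp2 res2 C20 HST2 R20 hr2 gL gB) fL.
  split => //; apply: le_trans est _; apply: lee_pmul.
  - by rewrite lee_fin !mulr_ge0.
  - exact: Lnorm_ge0.
  - rewrite lee_fin -subr_ge0.
    rewrite (_ : _ - _ = 4 * M * (f1 * f2) * (C1 + C2 + 1)); last by ring.
    by rewrite !mulr_ge0// addr_ge0// addr_ge0// ltW.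
  - exact: patch_mixed12 p10 p20 (measurableX mB1 mB2) fL.
- move=> R1 F A R10 mF bF sF [E1 [E2 [E [res1 res2 joint intA]]]] x1 r1 hr1.
  have [sp1 sp2 mG bG [M [N [M0 mN -> EN GM]]]] := prep _ _ _ _ _ _ R10 ltr01 res1 res2 joint mF bF.
  have r10 : 0 < r1 by apply: lt_le_trans hr1; rewrite invr_gt0.
  have mB1 := measurable_metric_ball doubling1 x1 r1.
  have [K1 K10 dom1] := Lnorm_le_L2 p12 mB1 (ball_fin doubling1 x1 r10).
  set f1 := restriction_factor mu1 _ _ _ _ _.
  have f10 : 0 <= f1 by exact: facge.
  have c10 : 0 <= C1 * f1 by rewrite mulr_ge0// ltW.
  have GS (l : R * R) : ~ ((@Num.sqrt R @^-1` `[0, R1]) `*` setT) l ->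
      F (Num.sqrt l.1, Num.sqrt l.2) = 0.
    by move=> Sl; apply: (supp_zero sF) => -[/= Sl1 _]; apply: Sl.
  rewrite -EFinM; apply: restricted_opnorm_le; first by rewrite !mulr_ge0.
  move=> f fL _.
  have [domA PL _ est] := joint_estimate sp1 sp2 joint intA mG bG M0 mN (mI R1) measurableT EN GM GS
    p12 h2 mB1 measurableT K10 ler01 dom1 (fun g _ _ => Lnorm_dom_id mu2 g) c10 ler01
    (fun g gL gB => ST_projection_supported doubling1 hp1 res1 C10 HST1 R10 hr1 gL gB)
    (fun g gL _ => spec_setT_bound sp2 gL) fL.
  split => //; apply: le_trans est _; apply: lee_pmul.
  - by rewrite lee_fin !mulr_ge0.
  - exact: Lnorm_ge0.
  - rewrite lee_fin -subr_ge0.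
    rewrite (_ : _ - _ = 4 * M * f1 * (C1 * C2 + C2 + 1)); last by ring.
    by rewrite !mulr_ge0// addr_ge0// addr_ge0// ?mulr_ge0// ltW.
  - exact: patch_mixed12 p10 (ler0n R 2) (measurableX mB1 measurableT) fL.
- move=> R2 F A R20 mF bF sF [E1 [E2 [E [res1 res2 joint intA]]]] x2 r2 hr2.
  have [sp1 sp2 mG bG [M [N [M0 mN -> EN GM]]]] := prep _ _ _ _ _ _ ltr01 R20 res1 res2 joint mF bF.
  have r20 : 0 < r2 by apply: lt_le_trans hr2; rewrite invr_gt0.
  have mB2 := measurable_metric_ball doubling2 x2 r2.
  have [K2 K20 dom2] := Lnorm_le_L2 p22 mB2 (ball_fin doubling2 x2 r20).
  set f2 := restriction_factor mu2 _ _ _ _ _.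
  have f20 : 0 <= f2 by exact: facge.
  have c20 : 0 <= C2 * f2 by rewrite mulr_ge0// ltW.
  have GS (l : R * R) : ~ (setT `*` (@Num.sqrt R @^-1` `[0, R2])) l ->
      F (Num.sqrt l.1, Num.sqrt l.2) = 0.
    by move=> Sl; apply: (supp_zero sF) => -[/= _ Sl2]; apply: Sl.
  rewrite -EFinM; apply: restricted_opnorm_le; first by rewrite !mulr_ge0.
  move=> f fL _.
  have [domA PL fin est] := joint_estimate sp1 sp2 joint intA mG bG M0 mN
    measurableT (mI R2) EN GM GS h2 p22 measurableT mB2 ler01 K20 (fun g _ _ => Lnorm_dom_id mu1 g) dom2 ler01 c20
    (fun g gL _ => spec_setT_bound sp1 gL)
    (fun g gL gB => ST_projection_supported doubling2 hp2 res2 C20 HST2 R20 hr2 gL gB) fL.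
  split => //; apply: le_trans est _; apply: lee_pmul.
  - by rewrite lee_fin !mulr_ge0.
  - exact: Lnorm_ge0.
  - rewrite lee_fin -subr_ge0.
    rewrite (_ : _ - _ = 4 * M * f2 * (C1 * C2 + C1 + 1)); last by ring.
    by rewrite !mulr_ge0// addr_ge0// addr_ge0// ?mulr_ge0// ltW.
  - have [mP _] := PL; apply: le_trans (mixed_norm12_le21 p22 mP fin) _.
    have [mf _] := fL; apply: le_mixed_norm21 => //.
    by move=> z; rewrite /patch; case: ifPn => // _; rewrite Normc.normc0 normc_ge0.
Qed.
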